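(* Let $N\ge1$ be an integer, $p=2N+1$, and for $v\in\mathbb{R}^p$ let $\lambda_{-N}(a,v)\le\dots\le\lambda_N(a,v)$ be the eigenvalues of $J_a=J_a(v)$, and $\lambda_k^\pm(v)$ the endpoints of the spectral bands $\sigma_k(v)$ of $H=\Delta+V$, as defined in the context. i) Each eigenvalue $\lambda_k(a,v)$, $\pm k\in\{1,\dots,N\}$, is a real analytic function of $(a,v)\in(0,2]\times\mathbb{R}^p$. For each small $\delta>0$ and all sufficiently small $v$ (depending on $\delta$), $\pm\partial_a^2\lambda_k(a,v)>0$ for $\pm k\in\{1,\dots,N\}$ and all $a\in[\delta,2]$. Moreover, $\lambda_0(\cdot,\cdot)$ is analytic in a neighborhood of $(0,0)\in\mathbb{R}\times\mathbb{R}^p$. ii) Let $c_j=\cos\frac{j\pi}{N+1}$, $s_j=\sin\frac{j\pi}{N+1}$ for $j\in\mathbb{Z}$. As $\|v\|^2=\sum_{n=1}^p|v_n|^2\to0$, for $k\in\{-N,\dots,N\}\setminus\{0\}$: $$\lambda_k^-(v)=s_{|k|}\,\mathrm{sign}\,k+\frac{1}{N+1}\sum_{n=1}^{N+1}\bigl(c_{nk}^2v_{2n-1}+s_{nk}^2v_{2n}\bigr)+O(\|v\|^2)\quad\text{if }|k|<\tfrac{N+1}{2},$$ (the term with $v_{2N+2}$ has coefficient $s_{(N+1)k}^2=0$ and is absent), $$\lambda_k^-(v)=\mathrm{sign}\,k+O(\|v\|)\quad\text{if }|k|\ge\tfrac{N+1}{2},$$ $$\lambda_k^+(v)=(5-4c_k)^{1/2}\,\mathrm{sign}\,k+\sum_{n=1}^p\frac{\chi_nv_n}{N+1}+O(\|v\|^2),\qquad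 \chi_{2n}=s_{kn}^2,\quad \chi_{2n+1}=\frac{(s_{nk}-2s_{(n+1)k})^2}{5-4c_k}.$$
   Context: Notation: $\mathbb{N}_p=\{1,\dots,p\}$, $p=2N+1$. The Hilbert space $\ell^2(\Gamma)$ consists of $f=(f_{n,k})_{(n,k)\in\mathbb{Z}\times\mathbb{N}_p}$ with $\sum|f_{n,k}|^2<\infty$. With $f_{n,0}=f_{n,p+1}=0$ for all $n\in\mathbb{Z}$, $H=\Delta+V$ is given by $$(\Delta f)_{n,2k+1}=f_{n,2k}+f_{n-1,2k+2}+f_{n,2k+2},\quad k=0,1,\dots,N,$$ $$(\Delta f)_{n,2k}=f_{n,2k-1}+f_{n+1,2k-1}+f_{n,2k+1},\quad k=1,\dots,N,$$ $$(Vf)_{n,k}=v_kf_{n,k},\quad (n,k)\in\mathbb{Z}\times\mathbb{N}_p,\qquad v=(v_k)_{k=1}^p\in\mathbb{R}^p.$$ For real $a$, $J_a=J_a(v)$ is the symmetric tridiagonal $p\times p$ matrix with diagonal $(v_1,\dots,v_p)$ and off-diagonal entries $(a,1,a,1,\dots,a,1)$ (the $(n,n+1)$ entry is $a$ for odd $n$ and $1$ for even $n$). The spectrum of $H$ is $\bigcup_{k=-N}^N\sigma_k(v)$, where $\sigma_k(v)=\{\lambda_k(a,v):a\in[0,2]\}$ is a compact interval (spectral band); its endpoints are denoted $\lambda_k^\pm(v)$ with $\sigma_k=[\lambda_k^-,\lambda_k^+]$ for $k\ge0$ and $\sigma_k=[\lambda_k^+,\lambda_k^-]$ for $k<0$.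 Thus $\lambda_k^-$ is the endpoint closer to $0$ for $k\neq 0$ and small $v$. *)

(* Defs.v *)
From mathcomp Require Import all_boot all_order all_algebra finmap.
From mathcomp Require Import all_classical all_reals all_analysis.
From mathcomp Require summability.

Set Implicit Arguments.
Unset Strict Implicit.
Unset Printing Implicit Defensive.

Import Order.TTheory GRing.Theory Num.Theory.
Import numFieldNormedType.Exports.

Local Open Scope classical_set_scope.
Local Open Scope ring_scope.

(* [f] is the sum of a power series in the increment [h] for all small [h].
   The multivariate series is indexed by multi-indices and converges as an
   unordered (equivalently, absolutely convergent) family. *)
Definition real_analytic_at (R : realType) (m : nat) (f : 'rV[R]_m -> R)
    (x : 'rV[R]_m) : Prop :=
  exists c : {ffun 'I_m -> nat} -> R,
  \forall h \near (0 : 'rV[R]_m),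
    (fun A : {fset {ffun 'I_m -> nat}} =>
       \sum_(alpha <- A) c alpha * \prod_(i < m) (h : 'rV[R]_m) 0 i ^+ alpha i)
      @ summability.totally --> f (x + h).

(* All eigenvalues, with algebraic multiplicity, in nondecreasing order;
   [::] if the characteristic polynomial does not split over [R], which does
   not happen for symmetric matrices. *)
Definition ordered_eigenvalues (R : realType) (n : nat) (A : 'M[R]_n) : seq R :=
  xget [::] [set s : seq R | sorted <=%R s /\
                             char_poly A = \prod_(x <- s) ('X - x%:P)].

Definition eucl_norm (R : realType) (n : nat) (v : 'rV[R]_n) : R :=
  Num.sqrt (\sum_(i < n) v 0 i ^+ 2).

(* Coordinates [v_1, ..., v_n] numbered from 1, extended by 0. *)
Definition coord1 (R : realType) (n : nat) (v : 'rV[R]_n) (j : nat) : R :=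
  if j is i.+1 then oapp (v 0) 0 (insub i : option 'I_n) else 0.

Section Bands.
Variables (R : realType) (N : nat).
Let p := (2 * N).+1.

(* Indices start at 0 here, so the off-diagonal entry in position (1,2) of the
   1-based numbering is the one with [minn i j = 0]. *)
Definition J (a : R) (v : 'rV[R]_p) : 'M[R]_p :=
  \matrix_(i, j)
    if i == j then v 0 i
    else if (i.+1 == j :> nat) || (j.+1 == i :> nat) then
      (if odd (minn i j) then 1 else a)
    else 0.

(* Meaningful for [- N <= k <= N]. *)
Definition lambda (k : int) (a : R) (v : 'rV[R]_p) : R :=
  nth 0 (ordered_eigenvalues (J a v)) (absz (k + N%:Z)).

(* [lambda k] as a function of the single vector [(a, v_1, ..., v_p)]. *)
Definition lambda_joint (k : int) (x : 'rV[R]_(1 + p)) : R :=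
  lambda k (lsubmx x 0 0) (rsubmx x).

Definition band (k : int) (v : 'rV[R]_p) : set R :=
  [set lambda k a v | a in `[0, 2]].

Definition lambda_minus (k : int) (v : 'rV[R]_p) : R :=
  if 0 <= k then inf (band k v) else sup (band k v).

Definition lambda_plus (k : int) (v : 'rV[R]_p) : R :=
  if 0 <= k then sup (band k v) else inf (band k v).

Definition c_ (j : int) : R := cos (j%:~R * pi / N.+1%:R).
Definition s_ (j : int) : R := sin (j%:~R * pi / N.+1%:R).

Definition chi (k : int) (m : nat) : R :=
  let n := m./2 in
  if odd m then
    (s_ (n%:Z * k) - 2 * s_ (n.+1%:Z * k)) ^+ 2 / (5 - 4 * c_ k)
  else s_ (k * n%:Z) ^+ 2.

End Bands.

(* Main.v *)
Require Import Defs.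
From mathcomp Require Import all_boot all_order all_algebra finmap perm.
From mathcomp Require Import ring lra zify.
From mathcomp Require Import all_classical all_reals all_analysis.
From mathcomp Require complex summability.

(** The matrix [J a v] is an analytic family, and for [a != 0] its spectrum is
    simple: the three-term recurrence determines an eigenvector from its first
    entry ([eigenvector_phi]), so two orthogonal eigenvectors cannot share an
    eigenvalue ([uniq_ordered_eigenvalues]).  Weyl's inequality
    ([eigenvalue_perturb]) makes every ordered eigenvalue Lipschitz in [(a, v)],
    and a continuous simple root of a polynomial whose coefficients are
    polynomials in the parameters is analytic ([simple_root_analytic], an
    implicit function theorem proved by iterating a contraction on polynomials
    with a weighted norm of the coefficients).  Near [(0, 0)] the eigenvalue of
    index 0 stays near [0] and all others stay near [1] or [-1], so that it is
    simple there too, although [a] may vanish.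

    At [v = 0] the matrix has explicit sine eigenvectors [psi0], and the
    eigenvalue of index [k] is
    [lambda0 k a = sg k * sqrt (1 + a^2 - 2 a c_k)
                 = sg k * sqrt (s_k^2 + (a - c_k)^2)].
    Hence [lambda0^3 * lambda0'' = s_k^2 > 0], so that the second derivative at
    [v = 0] has the sign of [k].  The derivative of an eigenvalue in [a] is an
    algebraic expression in [a], [v] and the eigenvalue itself (the quadratic
    form of [dJ/da] at the eigenvector), so the second derivative exists and is
    continuous in [(a, v)] for [a > 0] ([C1_eigval_derivative]); compactness of
    [[delta, 2]] extends the sign to all small [v] ([second_derivative_sign]).

    The function [a |-> |lambda0 k a|] is convex.  On [[0, 2]] it is largest at
    [a = 2], and it is smallest at [a = c_k] if [c_k > 0], that is if
    [|k| < (N + 1) / 2], and at [a = 0] otherwise.  First order perturbation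
    theory holds uniformly in [a] near any [a0 > 0] ([first_order]):
    [lambda k a v - lambda0 k a] is the average of [v] with weights
    [psi0 k a0 i ^ 2] up to an error [O(|v| (|a - a0| + |v|))].  At [a0 = c_k]
    the quadratic growth of [|lambda0|] beats the mixed error term, at [a0 = 2]
    its nonzero slope does, and in both cases the extremum over [a] is the value
    at [a0] up to [O(|v|^2)].  The coefficients of the theorem are the squared
    entries of [psi0], whose sum is [N + 1] whatever [a] is ([sum_psi0]).  If the
    minimum is at [a = 0], Weyl's inequality alone gives the error [O(|v|)]. *)

Set Implicit Arguments.
Unset Strict Implicit.
Unset Printing Implicit Defensive.

Import Order.TTheory GRing.Theory Num.Theory.
Import numFieldNormedType.Exports.

Local Open Scope classical_set_scope.
Local Open Scope ring_scope.

(** * Symmetric matrices: ordered eigenvalues and their perturbation *)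

Section Spectral.
Import complex sesquilinear spectral.
Local Open Scope sesquilinear_scope.
Variable R : realType.
Local Notation C := (complex R).
Local Notation toC := (real_complex R).

Lemma map_conj_toC n m (A : 'M[R]_(m, n)) :
  (map_mx toC A) ^ Num.conj = map_mx toC A.
Proof.
apply/matrixP => i j; rewrite !mxE; apply/CrealP.
by apply/complex_realP; exists (A i j).
Qed.

Lemma char_poly_similar (F : fieldType) n (P A D : 'M[F]_n) :
  P \in unitmx -> P *m A = D *m P -> char_poly A = char_poly D.
Proof.
move=> Pu PAD.
have PE : map_mx polyC P *m char_poly_mx A = char_poly_mx D *m map_mx polyC P.
  by rewrite mulmxBr mulmxBl -!map_mxM PAD /= -scalar_mxC.
have := congr1 determinant PE.
rewrite !det_mulmx mulrC => /mulIf; apply.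
by rewrite det_map_mx polyC_eq0 -unitfE -unitmxE.
Qed.

Lemma ordered_eigenvaluesE n (A : 'M[R]_n) (s : seq R) :
  sorted <=%R s -> char_poly A = \prod_(x <- s) ('X - x%:P) ->
  ordered_eigenvalues A = s.
Proof.
move=> ss sA; rewrite /ordered_eigenvalues; case: xgetP => [t _ [st tA]|].
  apply: (sorted_eq le_trans le_anti) => //.
  by apply: prod_XsubC_eq; rewrite -tA -sA.
by move/(_ s) => /(_ (conj ss sA)).
Qed.

(** The complex spectral theorem diagonalizes a real symmetric matrix; its
    eigenvalues being real, they can be sorted together with the eigenvectors. *)
Lemma symmetric_spectral n (A : 'M[R]_n) : A^T = A ->
  exists2 P : 'M[C]_n, P \is unitarymx &
  exists2 s : n.-tuple R, sorted <=%R s &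
    P *m map_mx toC A = diag_mx (\row_i toC (tnth s i)) *m P.
Proof.
move=> symA; set AC := map_mx toC A.
have hA : AC \is hermsymmx.
  apply/is_hermitianmxP.
  by rewrite expr0 scale1r /AC map_trmx symA map_conj_toC.
have /orthomx_spectralP := hermitian_normalmx hA.
have := spectral_unitarymx AC; have := hermitian_spectral_diag_real hA.
move: (spectralmx AC) (spectral_diag AC) => P D /mxOverP dR Pu AE.
have dE i : D 0 i = toC (complex.Re (D 0 i)) by rewrite RRe_real.
have PAC : P *m AC = diag_mx D *m P.
  by rewrite AE !mulmxA mulmxV ?mul1mx// unitarymx_unit.
pose d := fun i : 'I_n => complex.Re (D 0 i).
pose t := [tuple d i | i < n].
have /tuple_permP[p pE] : perm_eq (sort <=%R t) t by rewrite perm_sort.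
have szs : size (sort <=%R t) == n by rewrite size_sort size_tuple.
exists (row_perm p P).
  apply/unitarymxP; rewrite row_permE trmx_mul map_mxM !mulmxA.
  rewrite (mulmxtVK _ Pu) tr_perm_mx map_perm_mx -perm_mxM.
  by rewrite mulgV perm_mx1.
exists (Tuple szs) => /=; first exact/sort_sorted/le_total.
rewrite !row_permE -mulmxA PAC !mulmxA.
congr (_ *m _); apply/matrixP => i j.
have sE : tnth (Tuple szs) i = d (p i).
  rewrite (tnth_nth 0) /= pE.
  by rewrite (nth_map i) ?size_enum_ord// nth_ord_enum tnth_mktuple.
rewrite mul_mx_diag mul_diag_mx !mxE sE -dE.
by case: eqP => [<-|]; rewrite ?mul1r ?mulr1// ?mul0r ?mulr0.
Qed.

Lemma symmetric_spectralE n (A : 'M[R]_n) (P : 'M[C]_n) (s : n.-tuple R) :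
  P \is unitarymx -> sorted <=%R s ->
  P *m map_mx toC A = diag_mx (\row_i toC (tnth s i)) *m P ->
  char_poly A = \prod_(x <- s) ('X - x%:P) /\ ordered_eigenvalues A = s.
Proof.
move=> Pu ss PA.
suff cA : char_poly A = \prod_(x <- s) ('X - x%:P).
  by split=> //; exact: ordered_eigenvaluesE.
have := char_poly_similar (unitarymx_unit Pu) PA.
rewrite -map_char_poly (char_poly_trig (diag_mx_is_trig _)) => cE.
apply: (map_inj_poly (@complexI R) (rmorph0 _)); rewrite cE rmorph_prod.
rewrite big_tuple; apply: eq_bigr => i _.
by rewrite !mxE eqxx mulr1n rmorphB /= map_polyX map_polyC.
Qed.

Lemma ordered_eigenvaluesP n (A : 'M[R]_n) : A^T = A ->
  [/\ sorted <=%R (ordered_eigenvalues A), size (ordered_eigenvalues A) = n &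
      char_poly A = \prod_(x <- ordered_eigenvalues A) ('X - x%:P)].
Proof.
move=> /symmetric_spectral[P Pu [s ss PA]].
by have [cA ->] := symmetric_spectralE Pu ss PA; rewrite size_tuple.
Qed.

Let sqn n (u : 'rV[C]_n) := \sum_i `|u 0 i| ^+ 2.
Let qf n (A : 'M[C]_n) (x : 'rV[C]_n) := (x *m A *m x ^t*) 0 0.

Let qf_diag n (A P : 'M[C]_n) (s : n.-tuple R) (x : 'rV[C]_n) :
  P \is unitarymx -> P *m A = diag_mx (\row_i toC (tnth s i)) *m P ->
  qf A x = \sum_i toC (tnth s i) * `|(x *m P ^t*) 0 i| ^+ 2.
Proof.
move=> Pu PA; set u := x *m P ^t*.
have xE : x = u *m P by rewrite /u -{1}(invmx_unitary Pu) mulmxKV// unitarymx_unit.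
rewrite /qf xE -mulmxA trmx_mul map_mxM -2!mulmxA (mulmxA P) PA -mulmxA.
rewrite (mulmxA P) (unitarymxP Pu) mul1mx mulmxA -/u; clearbody u; rewrite mxE.
by apply: eq_bigr => i _; rewrite mul_diag_mx !mxE normCK mulrCA.
Qed.

Let qf1 n (x : 'rV[C]_n) : qf 1%:M x = sqn x.
Proof.
by rewrite /qf mulmx1 mxE; apply: eq_bigr => i _; rewrite !mxE normCK.
Qed.

Let sqn_unitary n (P : 'M[C]_n) (x : 'rV[C]_n) :
  P \is unitarymx -> sqn (x *m P ^t*) = sqn x.
Proof.
move=> Pu; rewrite -!qf1 /qf !mulmx1 trmx_mul map_mxM trmxCK.
by rewrite mulmxA mulmxKtV.
Qed.

Let sqn_gt0 n (x : 'rV[C]_n) : x != 0 -> 0 < sqn x.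
Proof.
move=> x0; rewrite lt_neqAle sumr_ge0 ?andbT; last first.
  by move=> i _; rewrite exprn_ge0.
apply: contra x0; rewrite eq_sym psumr_eq0; last by move=> i _; rewrite exprn_ge0.
move=> /allP h; apply/eqP/rowP => i; rewrite mxE.
by have := h i (mem_index_enum i); rewrite expf_eq0 /= normr_eq0 => /eqP.
Qed.

Let qf_entries n (E : 'M[R]_n) (eps : R) (x : 'rV[C]_n) :
  (forall i j, `|E i j| <= eps) ->
  `|qf (map_mx toC E) x| <= toC (n%:R * eps) * sqn x.
Proof.
move=> Ee.
have toC_norm (r : R) : `|toC r| = toC `|r|.
  by rewrite normc_def /= expr0n addr0 sqrtr_sqr.
have ij i j : `|x 0 i * toC (E i j) * (x 0 j)^*| <=
    toC eps / 2 * (`|x 0 i| ^+ 2 + `|x 0 j| ^+ 2).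
  rewrite !normrM norm_conjC toC_norm.
  apply: (@le_trans _ _ (toC eps * (`|x 0 i| * `|x 0 j|))).
    by rewrite mulrAC mulrC ler_wpM2r ?mulr_ge0// lecR.
  have e0 : 0 <= toC eps by rewrite ler0c; exact: le_trans (Ee i j).
  rewrite -mulrA ler_wpM2l// ler_pdivlMl//.
  rewrite -subr_ge0 (_ : _ - _ = (`|x 0 i| - `|x 0 j|) ^+ 2); last by ring.
  by rewrite -realEsqr rpredB// normr_real.
rewrite /qf mxE; under eq_bigr do rewrite mxE big_distrl /=.
apply: le_trans (ler_norm_sum _ _ _) _.
apply: (@le_trans _ _ (\sum_j \sum_i toC eps / 2 * (`|x 0 i| ^+ 2 + `|x 0 j| ^+ 2))).
  apply: ler_sum => j _; apply: le_trans (ler_norm_sum _ _ _) _.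
  by apply: ler_sum => i _; rewrite !mxE; exact: ij.
under eq_bigr do rewrite -mulr_sumr big_split /=.
rewrite -mulr_sumr big_split /= exchange_big /=.
under eq_bigr do rewrite sumr_const card_ord.
rewrite !sumrMnl -/(sqn x) rmorphM rmorph_nat -mulr_natl.
by rewrite le_eqVlt; apply/orP; left; apply/eqP; field.
Qed.

(** Weyl's inequality, with the operator norm of the perturbation bounded
    through its entries.  By a dimension count (the matrix [W] below has a
    zero column) some nonzero [x] is spanned by the eigenvectors of [A] of
    index at least [k] and also by those of [B] of index at most [k]. *)
Lemma eigenvalue_perturb n (A B : 'M[R]_n) (eps : R) (k : 'I_n) :
  A^T = A -> B^T = B -> (forall i j, `|A i j - B i j| <= eps) ->
  `|nth 0 (ordered_eigenvalues A) k - nth 0 (ordered_eigenvalues B) k|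
    <= n%:R * eps.
Proof.
wlog suff : A B / A^T = A -> B^T = B -> (forall i j, `|A i j - B i j| <= eps) ->
  nth 0 (ordered_eigenvalues A) k - nth 0 (ordered_eigenvalues B) k <= n%:R * eps.
  move=> hle sA sB ABe; rewrite ler_norml lerNl opprB.
  apply/andP; split; apply: hle => // i j.
  by rewrite distrC.
move=> symA symB ABe.
have [P Pu [s ss PA]] := symmetric_spectral symA.
have [Q Qu [t st QB]] := symmetric_spectral symB.
have [_ ->] := symmetric_spectralE Pu ss PA.
have [_ ->] := symmetric_spectralE Qu st QB.
pose W := \matrix_(i, j) (if (j < k)%N then (P ^t*) i j
                          else if (k < j)%N then (Q ^t*) i j else 0) : 'M[C]_n.
have /eqP/det0P[x x0 xW] : \det W = 0.
  rewrite (expand_det_col _ k) big1// => i _.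
  by rewrite !mxE ltnn mul0r.
have xP (i : 'I_n) : (i < k)%N -> (x *m P ^t*) 0 i = 0.
  move=> ik; transitivity ((x *m W) 0 i); last by rewrite xW mxE.
  by rewrite !mxE; apply: eq_bigr => j _; rewrite !mxE ik.
have xQ (i : 'I_n) : (k < i)%N -> (x *m Q ^t*) 0 i = 0.
  move=> ki; transitivity ((x *m W) 0 i); last by rewrite xW mxE.
  by rewrite !mxE; apply: eq_bigr => j _; rewrite !mxE ki ltnNge (ltnW ki).
have nthE (r : n.-tuple R) (i : 'I_n) : nth 0 r i = tnth r i by rewrite (tnth_nth 0).
have mono (r : n.-tuple R) (i j : 'I_n) : sorted <=%R r -> (i <= j)%N ->
    tnth r i <= tnth r j.
  move=> sr ij; rewrite -!nthE.
  by rewrite (sorted_leq_nth le_trans lexx 0 sr) ?inE ?size_tuple.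
have hA : toC (tnth s k) * sqn x <= qf (map_mx toC A) x.
  rewrite (qf_diag _ Pu PA) -(sqn_unitary _ Pu) mulr_sumr; apply: ler_sum => i _.
  have [ik|ki] := ltnP i k; first by rewrite xP// normr0 expr0n !mulr0.
  by rewrite ler_wpM2r ?exprn_ge0// lecR mono.
have hB : qf (map_mx toC B) x <= toC (tnth t k) * sqn x.
  rewrite (qf_diag _ Qu QB) -(sqn_unitary _ Qu) mulr_sumr; apply: ler_sum => i _.
  have [ki|ik] := ltnP k i; first by rewrite xQ// normr0 expr0n !mulr0.
  by rewrite ler_wpM2r ?exprn_ge0// lecR mono.
have qfB : qf (map_mx toC A) x - qf (map_mx toC B) x = qf (map_mx toC (A - B)) x.
  by rewrite /qf map_mxB mulmxBr mulmxBl !mxE.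
have hE : qf (map_mx toC (A - B)) x <= toC (n%:R * eps) * sqn x.
  have /real_ler_normlW : qf (map_mx toC (A - B)) x \is Num.real.
    rewrite -qfB (qf_diag _ Pu PA) (qf_diag _ Qu QB) rpredB// rpred_sum// => i _;
      by rewrite rpredM ?rpredX ?normr_real//; apply/complex_realP; eexists.
  by apply; apply: qf_entries => i j; rewrite !mxE.
rewrite !nthE -lecR -(ler_pM2r (sqn_gt0 x0)).
apply: le_trans hE; rewrite -qfB rmorphB mulrBl.
exact: lerB.
Qed.

(** If eigenvectors are determined by their first entry then no eigenvalue
    repeats: two rows of the diagonalizing unitary matrix with the same
    eigenvalue would have a combination whose first entry is zero. *)
Lemma uniq_ordered_eigenvalues n (A : 'M[R]_n.+1) : A^T = A ->
  (forall (x : R) (u : 'rV_n.+1), u *m A = x *: u -> u 0 0 = 0 -> u = 0) ->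
  uniq (ordered_eigenvalues A).
Proof.
move=> symA det0.
have [P Pu [s ss PA]] := symmetric_spectral symA.
have [_ ->] := symmetric_spectralE Pu ss PA.
have det0C (x : R) (w : 'rV[C]_n.+1) :
    w *m map_mx toC A = toC x *: w -> w 0 0 = 0 -> w = 0.
  move=> wA w0; pose re := map_mx (@complex.Re R) w; pose im := map_mx (@complex.Im R) w.
  have wE : w = map_mx toC re + 'i%C *: map_mx toC im.
    by apply/rowP => i; rewrite !mxE -complexE.
  have coefs i : toC ((re *m A) 0 i) + 'i%C * toC ((im *m A) 0 i) =
                 toC ((x *: re) 0 i) + 'i%C * toC ((x *: im) 0 i).
    have /rowP/(_ i) := wA.
    rewrite {1 2}wE mulmxDl -scalemxAl -!map_mxM scalerDr scalerA mulrC -scalerA.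
    by rewrite -!map_mxZ !mxE.
  have toC_rect (a b c d : R) :
      toC a + 'i%C * toC b = toC c + 'i%C * toC d -> a = c /\ b = d.
    by move=> [] /=; rewrite !(mul0r, mul1r, mulr0, subr0, addr0, add0r).
  have reA : re *m A = x *: re by apply/rowP => i; have [] := toC_rect _ _ _ _ (coefs i).
  have imA : im *m A = x *: im by apply/rowP => i; have [] := toC_rect _ _ _ _ (coefs i).
  have re0 : re = 0 by apply: (det0 _ _ reA); rewrite mxE w0.
  have im0 : im = 0 by apply: (det0 _ _ imA); rewrite mxE w0.
  by rewrite wE re0 im0 !map_mx0 scaler0 addr0.
have Prow i : row i P *m map_mx toC A = toC (tnth s i) *: row i P.
  by rewrite -row_mul PA; apply/rowP => j; rewrite mul_diag_mx !mxE.
apply/(uniqP 0) => i j; rewrite !inE !size_tuple => ilt jlt.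
pose i' := Ordinal ilt; pose j' := Ordinal jlt.
move=> nthij; have sij : tnth s i' = tnth s j' by rewrite !(tnth_nth 0).
suff : i' == j' by move/eqP/(congr1 val).
apply/negPn/negP => ij.
have ort (k l : 'I_n.+1) : (row k P *m (row l P) ^t*) 0 0 = (k == l)%:R.
  have /matrixP/(_ k l) := unitarymxP Pu.
  rewrite [in RHS]mxE => <-; rewrite !mxE.
  by apply: eq_bigr => m _; rewrite !mxE.
have /rowP w0 : P j' 0 *: row i' P - P i' 0 *: row j' P = 0.
  apply: (det0C (tnth s i')); last by rewrite !mxE mulrC subrr.
  rewrite mulmxBl -!scalemxAl !Prow -sij scalerBr.
  by rewrite !scalerA ![_ * toC _]mulrC.
have {}w0 : P j' 0 *: row i' P = P i' 0 *: row j' P.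
  by apply/rowP => m; have := w0 m; rewrite !mxE => /eqP; rewrite subr_eq0 => /eqP.
have P0 k l : k != l -> P l 0 *: row k P = P k 0 *: row l P -> P l 0 = 0.
  move=> kl kE; have := congr1 (fun u : 'rV_n.+1 => (u *m (row k P) ^t*) 0 0) kE.
  rewrite -!scalemxAl [in LHS]mxE [in RHS]mxE !ort eqxx mulr1.
  by rewrite eq_sym (negPf kl) mulr0.
have j0 := P0 _ _ ij w0.
have i0 : P i' 0 = 0 by apply: (P0 j' i'); rewrite 1?eq_sym// w0.
have /(congr1 (fun u : 'rV_n.+1 => (u *m (row i' P) ^t*) 0 0)) : row i' P = 0.
  by apply: det0C (Prow i') _; rewrite mxE.
by rewrite ort eqxx mul0mx mxE => /eqP; rewrite oner_eq0.
Qed.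

End Spectral.

(** * Power series and analytic roots *)

Section PowerSeries.
Variables (R : realType) (m : nat).
Implicit Types (h : 'rV[R]_m) (f g : 'rV[R]_m -> R).

(** A polynomial is represented by a list of terms, without collecting like
    terms, so that evaluation and weighted norm are both exactly
    multiplicative. *)
Notation multiindex := {ffun 'I_m -> nat}.
Notation terms := (seq (R * multiindex)).

Definition monomial h (alpha : multiindex) : R := \prod_(i < m) h 0 i ^+ alpha i.
Definition terms_eval (L : terms) h : R := \sum_(t <- L) t.1 * monomial h t.2.
Definition terms_norm (r : R) (L : terms) : R :=
  \sum_(t <- L) `|t.1| * \prod_(i < m) r ^+ t.2 i.
Definition terms_coef (L : terms) (alpha : multiindex) : R :=
  \sum_(t <- L | t.2 == alpha) t.1.

Definition terms_mul (L M : terms) : terms :=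
  [seq (t.1 * u.1, [ffun i => (t.2 i + u.2 i)%N]) | t : R * multiindex <- L,
                                                   u : R * multiindex <- M].

Lemma monomialD h (alpha beta : multiindex) :
  monomial h [ffun i => (alpha i + beta i)%N] = monomial h alpha * monomial h beta.
Proof.
by rewrite -big_split; apply: eq_bigr => i _; rewrite ffunE exprD.
Qed.

Lemma terms_eval_mul L M h :
  terms_eval (terms_mul L M) h = terms_eval L h * terms_eval M h.
Proof.
rewrite /terms_eval big_allpairs_dep big_distrlr /=; apply: eq_bigr => t _.
by apply: eq_bigr => u _; rewrite monomialD mulrACA.
Qed.

Lemma terms_norm_mul r L M :
  terms_norm r (terms_mul L M) = terms_norm r L * terms_norm r M.
Proof.
rewrite /terms_norm big_allpairs_dep big_distrlr /=; apply: eq_bigr => t _.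
apply: eq_bigr => u _; rewrite normrM mulrACA -big_split /=.
by congr (_ * _); apply: eq_bigr => i _; rewrite ffunE exprD.
Qed.

Lemma norm_monomial (r : R) h alpha : (forall i, `|h 0 i| <= r) ->
  `|monomial h alpha| <= \prod_(i < m) r ^+ alpha i.
Proof.
move=> hr; rewrite normr_prod ler_prod// => i _.
by rewrite normr_ge0 normrX lerXn2r ?nnegrE// (le_trans (normr_ge0 (h 0 i))).
Qed.

Lemma norm_terms_eval (r : R) (P : pred (R * multiindex)) (L : terms) h :
  (forall i, `|h 0 i| <= r) ->
  `|\sum_(t <- L | P t) t.1 * monomial h t.2| <= terms_norm r L.
Proof.
move=> hr; have r0 (t : R * multiindex) : 0 <= \prod_(i < m) r ^+ t.2 i.
  by apply: prodr_ge0 => i _; rewrite exprn_ge0// (le_trans (normr_ge0 (h 0 i))).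
rewrite /terms_norm [leRHS](bigID P) /= -[leLHS]addr0 lerD ?sumr_ge0//; last first.
  by move=> t _; rewrite mulr_ge0.
apply: le_trans (ler_norm_sum _ _ _) (ler_sum _ _) => t _.
by rewrite normrM ler_wpM2l// norm_monomial.
Qed.

(** The least such [M] is the norm of a Banach algebra of power series on the
    polydisc of radius [r], and it dominates the supremum of [f] there.  An
    upper bound is carried along in its place, because different lists can
    represent the same function. *)
Definition poly_bound (r : R) f (M : R) :=
  exists2 L : terms, f =1 terms_eval L & terms_norm r L <= M.

Definition poly_fun f := exists L : terms, f =1 terms_eval L.

Section Closure.
Variable r : R.
Hypothesis r_ge0 : 0 <= r.

Lemma terms_norm_ge0 L : 0 <= terms_norm r L.
Proof.
apply: sumr_ge0 => t _; rewrite mulr_ge0// prodr_ge0// => i _.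
by rewrite exprn_ge0.
Qed.

Lemma poly_bound_ge0 f M : poly_bound r f M -> 0 <= M.
Proof. by move=> [L _]; apply: le_trans; exact: terms_norm_ge0. Qed.

Lemma poly_bound_le f M N : M <= N -> poly_bound r f M -> poly_bound r f N.
Proof. by move=> MN [L fL LM]; exists L => //; exact: le_trans MN. Qed.

Lemma poly_bound_const c : poly_bound r (fun=> c) `|c|.
Proof.
exists [:: (c, [ffun=> 0%N])] => [h|]; rewrite /terms_eval /terms_norm big_seq1 /=.
  by rewrite /monomial big1 ?mulr1// => i _; rewrite ffunE.
by rewrite big1 ?mulr1// => i _; rewrite ffunE.
Qed.

Lemma poly_boundD f g M N : poly_bound r f M -> poly_bound r g N ->
  poly_bound r (fun h => f h + g h) (M + N).
Proof.
move=> [L fL LM] [L' gL LN]; exists (L ++ L') => [h|].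
  by rewrite /terms_eval big_cat fL gL.
by rewrite /terms_norm big_cat lerD.
Qed.

Lemma poly_boundM f g M N : poly_bound r f M -> poly_bound r g N ->
  poly_bound r (fun h => f h * g h) (M * N).
Proof.
move=> [L fL LM] [L' gL LN]; exists (terms_mul L L') => [h|].
  by rewrite terms_eval_mul fL gL.
by rewrite terms_norm_mul ler_pM// terms_norm_ge0.
Qed.

Lemma poly_boundX f M n : poly_bound r f M -> poly_bound r (fun h => f h ^+ n) (M ^+ n).
Proof.
move=> fM; elim: n => [|n IH].
  by apply: poly_bound_le (poly_bound_const 1); rewrite normr1.
have [L fL LM] := poly_boundM fM IH; exists L; last by rewrite exprS.
by move=> h; rewrite exprS fL.
Qed.

Lemma poly_bound_sum (I : Type) (s : seq I) (F : I -> 'rV[R]_m -> R) (M : I -> R) :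
  (forall i, poly_bound r (F i) (M i)) ->
  poly_bound r (fun h => \sum_(i <- s) F i h) (\sum_(i <- s) M i).
Proof.
move=> FM; elim: s => [|i s IH].
  rewrite big_nil; exists [::]; last by rewrite /terms_norm big_nil.
  by move=> h; rewrite big_nil /terms_eval big_nil.
have [L fL LM] := poly_boundD (FM i) IH; exists L; last by rewrite big_cons.
by move=> h; rewrite big_cons fL.
Qed.

End Closure.

Lemma poly_fun_bound f : poly_fun f ->
  exists2 K, 0 <= K & forall r, 0 <= r <= 1 -> poly_bound r f K.
Proof.
move=> [L fL]; exists (terms_norm 1 L); first exact: terms_norm_ge0.
move=> r /andP[r0 r1]; exists L => //; apply: ler_sum => t _.
rewrite ler_wpM2l// ler_prod// => i _.
by rewrite exprn_ge0//= expr1n exprn_ile1.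
Qed.

(** Without a constant term the norm vanishes with the radius; the constant
    terms of the list cancel and can be dropped. *)
Lemma poly_fun_bound0 f : poly_fun f -> f 0 = 0 ->
  exists2 K, 0 <= K & forall r, 0 <= r <= 1 -> poly_bound r f (K * r).
Proof.
move=> [L fL] f0; pose L' := [seq t <- L | t.2 != [ffun=> 0%N]].
exists (terms_norm 1 L'); first exact: terms_norm_ge0.
move=> r /andP[r0 r1]; exists L' => [h|]; last first.
  rewrite /terms_norm big_distrl /= 2!big_filter; apply: ler_sum => t t0.
  rewrite -mulrA ler_wpM2l//.
  have [i ti0] : exists i, t.2 i != 0%N.
    apply/existsP; apply: contraNT t0 => /existsPn ti; apply/eqP/ffunP => i.
    by have := ti i; rewrite negbK ffunE => /eqP.
  rewrite (bigD1 i)//= [in leRHS]big1 ?mul1r; last by move=> j _; rewrite expr1n.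
  rewrite -[leRHS]mulr1 ler_pM//.
  - by rewrite exprn_ge0.
  - by apply: prodr_ge0 => j _; rewrite exprn_ge0.
  - by case: (t.2 i) ti0 => // n _; rewrite exprS ler_piMr// exprn_ile1.
  - by apply: prodr_ile1 => j; rewrite exprn_ge0//= exprn_ile1.
have cst h' (t : R * multiindex) : t.2 == [ffun=> 0%N] -> monomial h' t.2 = 1.
  by move=> /eqP->; rewrite /monomial big1// => i _; rewrite ffunE.
rewrite fL /terms_eval (bigID (fun t => t.2 != [ffun=> 0%N])) /= -big_filter.
rewrite -[RHS]addr0; congr (_ + _); rewrite -[RHS]f0 fL /terms_eval.
rewrite [RHS](bigID (fun t => t.2 != [ffun=> 0%N])) /= [X in _ = X + _]big1 ?add0r.
  by apply: eq_bigr => t; rewrite negbK => /cst ht; rewrite !ht.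
move=> t t0; have [i ti0] : exists i, t.2 i != 0%N.
  apply/existsP; apply: contraNT t0 => /existsPn ti; apply/eqP/ffunP => i.
  by have := ti i; rewrite negbK ffunE => /eqP.
by rewrite /monomial (bigD1 i)//= mxE expr0n (negPf ti0) mul0r mulr0.
Qed.

Lemma poly_fun_ext f g : f =1 g -> poly_fun f -> poly_fun g.
Proof. by move=> fg [L fL]; exists L => h; rewrite -fg fL. Qed.

Lemma poly_fun_const c : poly_fun (fun=> c).
Proof. by have [L fL _] := poly_bound_const 0 c; exists L. Qed.

Lemma poly_funD f g : poly_fun f -> poly_fun g -> poly_fun (fun h => f h + g h).
Proof.
move=> [L fL] [L' gL]; exists (L ++ L') => h.
by rewrite fL gL /terms_eval big_cat.
Qed.

Lemma poly_funM f g : poly_fun f -> poly_fun g -> poly_fun (fun h => f h * g h).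
Proof.
by move=> [L fL] [L' gL]; exists (terms_mul L L') => h; rewrite fL gL terms_eval_mul.
Qed.

Lemma poly_fun_coord i : poly_fun (fun h => h 0 i).
Proof.
exists [:: (1, [ffun j => (j == i : nat)])] => h.
rewrite /terms_eval big_seq1 mul1r /monomial (bigD1 i)//= ffunE eqxx expr1.
by rewrite big1 ?mulr1// => j /negPf ji; rewrite ffunE ji.
Qed.

Lemma poly_fun_sum (I : Type) (s : seq I) (P : pred I) (F : I -> 'rV[R]_m -> R) :
  (forall i, poly_fun (F i)) -> poly_fun (fun h => \sum_(i <- s | P i) F i h).
Proof.
move=> PF; elim: s => [|i s IH].
  by apply: poly_fun_ext (poly_fun_const 0) => h; rewrite big_nil.
case Pi: (P i).
  by apply: poly_fun_ext (poly_funD (PF i) IH) => h; rewrite big_cons Pi.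
by apply: poly_fun_ext IH => h; rewrite big_cons Pi.
Qed.

(** Completeness: collecting like terms in a series of polynomials whose
    norms are summable gives a convergent power series with the same sum. *)
Lemma power_series_of_series (r : R) (d : nat -> 'rV[R]_m -> R) (M : nat -> R) :
  0 < r -> (forall n, poly_bound r (d n) (M n)) -> cvgn (series M) ->
  exists c : multiindex -> R, forall h (l : R), (forall i, `|h 0 i| <= r) ->
    series (d ^~ h) @ \oo --> l ->
    (fun A : {fset multiindex} => \sum_(alpha <- A) c alpha * monomial h alpha)
      @ summability.totally --> l.
Proof.
move=> r0 dM cM.
have M0 n : 0 <= M n by apply: (poly_bound_ge0 (ltW r0) (dM n)).
have /choice[L dL] : forall n, exists L : terms, d n =1 terms_eval L /\ terms_norm r L <= M n.
  by move=> n; have [L ? ?] := dM n; exists L.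
pose w (alpha : multiindex) := \prod_(i < m) r ^+ alpha i.
have w0 alpha : 0 < w alpha by apply: prodr_gt0 => i _; rewrite exprn_gt0.
have coefL n alpha : `|terms_coef (L n) alpha| * w alpha <= M n.
  apply: le_trans (proj2 (dL n)).
  rewrite /terms_norm (bigID (fun t => t.2 == alpha)) /= -[leLHS]addr0.
  apply: lerD; last by apply: sumr_ge0 => t _; rewrite mulr_ge0// ltW// w0.
  apply: (@le_trans _ _ (\sum_(t <- L n | t.2 == alpha) `|t.1| * w alpha)).
    by rewrite -mulr_suml ler_wpM2r ?(ltW (w0 _))//; apply: ler_norm_sum.
  by apply: ler_sum => t /eqP <-.
have cc alpha : cvgn (series (fun n => terms_coef (L n) alpha)).
  apply: normed_cvg; apply: (@series_le_cvg _ _ (fun n => M n / w alpha)).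
  - by move=> n; exact: normr_ge0.
  - by move=> n; rewrite divr_ge0// ltW.
  - by move=> n /=; rewrite ler_pdivlMr.
  - rewrite [X in cvgn X](_ : _ = (fun n => (w alpha)^-1 * series M n)).
      by apply: is_cvgM => //; exact: is_cvg_cst.
    by apply/funext => n; rewrite /series /= mulr_sumr; apply: eq_bigr => i _; rewrite mulrC.
exists (fun alpha => limn (series (fun n => terms_coef (L n) alpha))) => h l hr dl.
have sumA (A : {fset multiindex}) n :
    \sum_(alpha <- A) terms_coef (L n) alpha * monomial h alpha =
    \sum_(t <- L n | t.2 \in A) t.1 * monomial h t.2.
  under eq_bigr do rewrite /terms_coef mulr_suml.
  rewrite (exchange_big_dep xpredT)// [RHS]big_mkcond; apply: eq_bigr => t _.
  case: ifPn => tA.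
    rewrite -big_filter (_ : [seq _ <- _ | _] = [:: t.2]) ?big_seq1//.
    rewrite (eq_filter (a2 := pred1 t.2)); last by move=> x; rewrite inE eq_sym.
    by rewrite filter_pred1_uniq ?fset_uniq.
  rewrite -big_filter (_ : [seq _ <- _ | _] = [::]) ?big_nil//.
  apply/eqP; rewrite -size_eq0 size_filter eqn0Ngt -has_count.
  by apply/hasPn => x xA; apply: contraNN tA => /eqP ->.
have limA (A : {fset multiindex}) :
    series (fun n => \sum_(alpha <- A) terms_coef (L n) alpha * monomial h alpha) n @[n --> \oo]
    --> \sum_(alpha <- A) limn (series (fun n => terms_coef (L n) alpha)) * monomial h alpha.
  rewrite (_ : series _ = fun n => \sum_(alpha <- A)
      (series (fun k => terms_coef (L k) alpha) n * monomial h alpha)); last first.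
    apply/funext => n; rewrite /series /= exchange_big /=.
    by apply: eq_bigr => alpha _; rewrite mulr_suml.
  apply: cvg_big => [|alpha _]; first exact: add_continuous.
  by apply: cvgM; [exact: cc|exact: cvg_cst].
have FF := @summability.totally_filter multiindex.
apply/cvgrPdist_le => e e0.
have /cauchy_seriesP/(_ _ e0) : cauchy (series M @ \oo) by exact: cvg_cauchy.
move=> [[I1 I2] /= [[n1 _ In1] [n2 _ In2]] IM].
pose n0 := maxn n1 n2.
have tail n : (n0 <= n)%N -> \sum_(n0 <= k < n) M k <= e.
  move=> n0n; rewrite ltW// (le_lt_trans (ler_norm _))//; apply: (IM (n0, n)).
  by split => /=; [apply: In1|apply: In2] => /=; rewrite /n0; lia.
(* All monomials of the first [n0] polynomials: beyond [A0] only the tail of the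
   series of norms is missing. *)
pose A0 : {fset multiindex} := [fset alpha in flatten [seq [seq t.2 | t <- L k] | k <- iota 0 n0]]%fset.
exists A0 => // A /= /fsubsetP A0A.
have diff n : (n0 <= n)%N ->
    `|series (d ^~ h) n - series (fun n => \sum_(alpha <- A) terms_coef (L n) alpha * monomial h alpha) n| <= e.
  move=> n0n; apply: le_trans (tail n n0n).
  rewrite /series /= -sumrB (big_cat_nat (leq0n n0) n0n) /= big_nat big1 ?add0r.
    apply: le_trans (ler_norm_sum _ _ _) (ler_sum _ _) => k _.
    rewrite sumA (proj1 (dL k)) /terms_eval [X in X - _](bigID (fun t => t.2 \in A)) /= addrAC subrr add0r.
    by apply: le_trans (proj2 (dL k)); exact: norm_terms_eval.
  move=> k /andP[_ kn0]; rewrite sumA (proj1 (dL k)) /terms_eval.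
  rewrite [X in _ - X](_ : _ = \sum_(t <- L k) t.1 * monomial h t.2) ?subrr//.
  rewrite big_seq_cond [RHS]big_seq_cond; apply: eq_bigl => t; rewrite andbT.
  case tL: (t \in L k) => //=; apply: A0A; rewrite inE /=.
  apply/flattenP; exists [seq t.2 | t <- L k]; last exact: map_f.
  by apply/mapP; exists k => //; rewrite mem_iota.
have lim_diff := cvg_norm (cvgB dl (limA A)).
rewrite -(cvg_lim _ (lim_diff _ _))//; apply: limr_le; first exact: cvgP (lim_diff _ _).
by exists n0 => // n /= n0n; exact: diff.
Qed.

Lemma row_coord_le h i : `|h 0 i| <= `|h|.
Proof. by rewrite [leRHS]/Num.norm /= mx_normrE; apply: (le_bigmax _ (fun ij => `|h ij.1 ij.2|) (0, i)). Qed.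

(** The equation determines a contraction, on functions as well as on lists of
    terms of small norm.  Iterating it from [0] gives polynomials [y k] which
    converge to [z] and whose increments have geometrically decreasing norms. *)
Lemma fixed_point_power_series n (g : nat -> 'rV[R]_m -> R) (z : 'rV[R]_m -> R) :
  (forall j, poly_fun (g j)) -> g 0 0 = 0 -> g 1 0 = 0 ->
  (forall e, 0 < e -> \forall h \near (0 : 'rV[R]_m), `|z h| <= e) ->
  (\forall h \near (0 : 'rV[R]_m), z h = \sum_(j < n) g j h * z h ^+ j) ->
  exists c : multiindex -> R, \forall h \near (0 : 'rV[R]_m),
    (fun A : {fset multiindex} => \sum_(alpha <- A) c alpha * monomial h alpha)
      @ summability.totally --> z h.
Proof.
move=> pg g00 g10 z0 zE.
have /choice[K0 K0P] j : exists K, 0 <= K /\ forall r, 0 <= r <= 1 ->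
    poly_bound r (g j) (if (j < 2)%N then K * r else K).
  case: j => [|[|j]] /=.
  - by have [K ? ?] := poly_fun_bound0 (pg 0%N) g00; exists K.
  - by have [K ? ?] := poly_fun_bound0 (pg 1%N) g10; exists K.
  - by have [K ? ?] := poly_fun_bound (pg j.+2); exists K.
pose K := 1 + \sum_(j < n) K0 j.
have K0_ge0 j : 0 <= K0 j by have [] := K0P j.
have K1 : 1 <= K by rewrite lerDl sumr_ge0.
have K0K (j : 'I_n) : K0 j <= K.
  by rewrite /K (bigD1 j)//= addrCA lerDl addr_ge0// sumr_ge0.
have Kpos : 0 < K by exact: lt_le_trans K1.
pose nn : R := n.+1%:R.
have nn1 : 1 <= nn by rewrite ler1n.
have nnpos : 0 < nn by exact: lt_le_trans nn1.
(* [K] bounds the coefficients [g j] and [K * r] those with [j < 2], which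
   vanish at [0]; the iterates [y k] stay in the ball of radius [rho] of the
   norm with weight [r], where [T] below has Lipschitz constant at most [1/2]. *)
pose rho := (4 * K * nn ^+ 2)^-1.
have KN : 4 <= 4 * K * nn ^+ 2.
  by rewrite -mulrA ler_peMr// mulr_ege1// exprn_ege1.
have rho0 : 0 < rho by rewrite invr_gt0; lra.
have rho1 : rho <= 1 by rewrite invf_le1; lra.
have Krho : K * nn ^+ 2 * rho = 1 / 4.
  by rewrite /rho; field; rewrite !lt0r_neq0.
pose r := rho / (4 * K * nn).
have r0 : 0 < r by rewrite divr_gt0// !mulr_gt0.
have Kr : K * r = rho / (4 * nn) by rewrite /r; field; rewrite !lt0r_neq0.
have Kr_rho : K * r <= rho.
  by rewrite Kr ler_pdivrMr ?mulr_gt0// ler_peMr ?ltW//; lra.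
have r1 : r <= 1.
  have : r <= K * r by rewrite ler_peMl// ltW.
  lra.
have [K_ge0 nn_ge0 rho_ge0 r_ge0] : [/\ 0 <= K, 0 <= nn, 0 <= rho & 0 <= r] by rewrite !ltW.
pose b j := if (j < 2)%N then K * r else K.
have b0 j : 0 <= b j by rewrite /b; case: ifP => _; rewrite ltW// mulr_gt0.
have gb (j : 'I_n) : poly_bound r (g j) (b j).
  have [_ /(_ r)] := K0P j; rewrite (ltW r0) r1 => /(_ isT).
  by apply: poly_bound_le; rewrite /b; case: ifP => _; rewrite ?ler_wpM2r.
pose T (y : 'rV[R]_m -> R) h := \sum_(j < n) g j h * y h ^+ j.
pose S (y w : 'rV[R]_m -> R) h :=
  \sum_(j < n) g j h * \sum_(i < j) y h ^+ (j.-1 - i) * w h ^+ i.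
have TB y w h : T y h - T w h = (y h - w h) * S y w h.
  rewrite /T /S mulr_sumr -sumrB; apply: eq_bigr => j _.
  rewrite -mulrBr mulrCA; congr (_ * _).
  by case: (val j) => [|k]; [rewrite big_ord0 !expr0 subrr mulr0|rewrite subrXX].
pose q := \sum_(j < n) b j * \sum_(i < j) rho ^+ (j.-1 - i) * rho ^+ i.
have qj (j : 'I_n) : b j * \sum_(i < j) rho ^+ (j.-1 - i) * rho ^+ i <= (2 * nn)^-1.
  have -> : \sum_(i < j) rho ^+ (j.-1 - i) * rho ^+ i = j%:R * rho ^+ j.-1.
    rewrite (eq_bigr (fun=> rho ^+ j.-1)) ?sumr_const ?card_ord ?mulr_natl// => i _.
    by rewrite -exprD subnK// -ltnS prednK// (leq_ltn_trans _ (ltn_ord i)).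
  have jn : (j : nat)%:R <= nn by rewrite ler_nat ltnW// ltnS ltnW.
  have nninv : 2 * K * rho * nn = (2 * nn)^-1.
    by rewrite /rho; field; rewrite !lt0r_neq0.
  rewrite -nninv /b; case: ltnP => j2.
    case: (nat_of_ord j) j2 jn => [|[|//]] _ jn.
      by rewrite mul0r mulr0 !mulr_ge0// ltW.
    rewrite expr0 !mulr1.
    apply: (@le_trans _ _ (K * rho * nn)); last first.
      by rewrite -!mulrA ler_peMl ?mulr_ge0//; lra.
    apply: le_trans Kr_rho _.
    by rewrite mulrAC ler_peMl ?mulr_ege1.
  apply: (@le_trans _ _ (K * (nn * rho))).
    rewrite ler_wpM2l // ler_pM// ?exprn_ge0 //.
    by case: (nat_of_ord j) j2 => [|[|k]]//= _; rewrite exprS ler_piMr ?exprn_ile1.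
  have : 0 <= K * (nn * rho) by rewrite !mulr_ge0.
  lra.
have q2 : q <= 1 / 2.
  apply: (@le_trans _ _ (\sum_(j < n) (2 * nn)^-1)); first exact: ler_sum.
  rewrite sumr_const card_ord -[leLHS]mulr_natl ler_pdivrMr ?mulr_gt0//.
  have : (n%:R : R) <= nn by rewrite ler_nat.
  lra.
have Trho : \sum_(j < n) b j * rho ^+ j <= rho.
  apply: (@le_trans _ _ (\sum_(j < n) rho * (2 * nn)^-1)).
    apply: ler_sum => j _; have := qj j.
    have Kr2 : K * r <= rho * (2 * nn)^-1.
      by rewrite Kr ler_wpM2l // lef_pV2 ?posrE ?mulr_gt0//; lra.
    case: (nat_of_ord j) => [|k] jb; first by rewrite expr0 mulr1.
    rewrite exprS mulrCA ler_wpM2l //; apply: le_trans jb.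
    rewrite ler_wpM2l//= big_ord_recl subn0 expr0 mulr1 lerDl sumr_ge0// => i _.
    by rewrite mulr_ge0 ?exprn_ge0.
  rewrite sumr_const card_ord -[leLHS]mulr_natl mulrCA ler_piMr //.
  rewrite ler_pdivrMr ?mulr_gt0//.
  have : (n%:R : R) <= nn by rewrite ler_nat.
  lra.
pose y k := iter k T (fun=> 0).
have yb k : poly_bound r (y k) rho.
  elim: k => [|k IH] /=.
    by apply: poly_bound_le (poly_bound_const r 0); rewrite normr0.
  apply: poly_bound_le Trho _; apply: poly_bound_sum => j.
  by apply: poly_boundM; [by []|exact: gb|exact: poly_boundX].
have Sb v w : poly_bound r v rho -> poly_bound r w rho -> poly_bound r (S v w) (1 / 2).
  move=> vb wb; apply: poly_bound_le q2 _; apply: poly_bound_sum => j.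
  apply: poly_boundM => //; apply: poly_bound_sum => i.
  by apply: poly_boundM => //; apply: poly_boundX.
pose d k h := y k.+1 h - y k h.
have db k : poly_bound r (d k) (rho * (1 / 2) ^+ k).
  elim: k => [|k IH].
    have [L yL Lb] := yb 1%N; exists L; last by rewrite expr0 mulr1.
    by move=> h; rewrite /d /= subr0 -yL.
  have [L yL Lb] := poly_boundM r_ge0 IH (Sb _ _ (yb k.+1) (yb k)).
  exists L; last by rewrite exprSr mulrA.
  by move=> h; rewrite -yL -TB.
have cd : cvgn (series (fun k => rho * (1 / 2) ^+ k)).
  by apply: is_cvg_geometric_series; rewrite ger0_norm; lra.
have [c cP] := power_series_of_series r0 db cd.
have val_le f M h : (forall i, `|h 0 i| <= r) -> poly_bound r f M -> `|f h| <= M.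
  move=> hr [L -> Lb]; apply: le_trans Lb.
  exact: (norm_terms_eval xpredT).
have near_r : \forall h \near (0 : 'rV[R]_m), `|h| <= r.
  exact: nbhs0_le.
exists c; near=> h.
have hr i : `|h 0 i| <= r.
  by apply: le_trans (row_coord_le h i) _; near: h.
have zrho : `|z h| <= rho.
  by near: h; exact: z0.
have zT : z h = T z h by near: h.
apply: cP => //.
have yz k : `|z h - y k h| <= rho * (1 / 2) ^+ k.
  elim: k => [|k IH]; first by rewrite expr0 mulr1 subr0.
  rewrite [in leLHS]zT /= TB normrM exprSr mulrA; apply: ler_pM => //.
  apply: le_trans q2; apply: le_trans (ler_norm_sum _ _ _) (ler_sum _ _) => j _.
  rewrite normrM ler_pM ?(val_le _ _ _ hr (gb j))//.
  apply: le_trans (ler_norm_sum _ _ _) (ler_sum _ _) => i _.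
  rewrite normrM !normrX ler_pM ?exprn_ge0// lerXn2r ?nnegrE //.
  exact: val_le (yb k).
rewrite (_ : series _ = fun k => y k h); last first.
  apply/funext => k; rewrite /series /=; elim: k => [|k IH]; first by rewrite big_geq.
  by rewrite big_nat_recr//= IH /d addrCA subrr addr0.
apply/cvgrPdist_le => e e0.
have /cvgrPdist_le/(_ _ e0) : (fun k => rho * (1 / 2) ^+ k) @ \oo --> (0 : R).
  by apply: cvg_geometric; rewrite ger0_norm; lra.
apply: filterS => k; rewrite sub0r normrN => ke.
by apply: le_trans (yz k) (le_trans (ler_norm _) ke).
Unshelve. all: by end_near. Qed.

(** A continuous simple root of a polynomial whose coefficients are polynomial
    functions of the parameters is analytic: after dividing by the derivative,
    the equation for the increment of the root has no constant and no linear
    coefficient at the base point. *)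
Theorem simple_root_analytic n (P : 'rV[R]_m -> {poly R}) (root_fun : 'rV[R]_m -> R) (x0 : 'rV[R]_m) :
  (forall x, (size (P x) <= n)%N) ->
  (forall j, poly_fun (fun h => (P (x0 + h))`_j)) ->
  {for x0, continuous root_fun} ->
  (\forall x \near x0, root (P x) (root_fun x)) ->
  ~~ root (P x0)^`() (root_fun x0) ->
  real_analytic_at root_fun x0.
Proof.
move=> sP pP cf rP dP; set l0 := root_fun x0.
pose Q h := P (x0 + h) \Po ('X + l0%:P).
have QE h : Q h = \sum_(i < n) (P (x0 + h))`_i *: ('X + l0%:P) ^+ i.
  rewrite [LHS](_ : _ = (\poly_(i < n) (P (x0 + h))`_i) \Po ('X + l0%:P)).
    rewrite poly_def raddf_sum; apply: eq_bigr => i _.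
    by rewrite /= linearZ /= comp_Xn_poly.
  congr (_ \Po _); apply/polyP => i; rewrite coef_poly; case: ltnP => // ni.
  by rewrite nth_default// (leq_trans (sP _)).
have pQ j : poly_fun (fun h => (Q h)`_j).
  apply: (@poly_fun_ext (fun h => \sum_(i < n) (P (x0 + h))`_i * (('X + l0%:P) ^+ i)`_j)).
    by move=> h; rewrite QE coef_sum; apply: eq_bigr => i _; rewrite coefZ.
  apply: poly_fun_sum => i; exact: poly_funM (pP i) (poly_fun_const _).
have sQ h : (size (Q h) <= n)%N by rewrite size_comp_poly2// size_XaddC.
have e1E : (Q 0)`_1 = (P x0)^`().[l0].
  rewrite /Q addr0.
  have := congr1 (fun p => p.[0]) (deriv_comp (P x0) ('X + l0%:P)).
  by rewrite derivD derivX derivC addr0 mulr1 horner_comp !hornerE horner_coef0 coef_deriv mulr1n.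
set e1 := (Q 0)`_1 in e1E; have e1n0 : e1 != 0 by rewrite e1E.
pose g j h : R := if j == 1%N then 1 - (Q h)`_1 / e1 else - ((Q h)`_j / e1).
have pg j : poly_fun (g j).
  have pj : poly_fun (fun h => - e1^-1 * (Q h)`_j) by exact: poly_funM (poly_fun_const _) (pQ j).
  rewrite /g; case: eqP => [j1|_].
    apply: poly_fun_ext (poly_funD (poly_fun_const 1) pj) => h.
    by rewrite j1 mulNr mulrC.
  by apply: poly_fun_ext pj => h; rewrite mulNr mulrC.
have n2 : (1 < n)%N.
  rewrite ltnNge; apply: contra e1n0 => n1.
  by rewrite /e1 nth_default// (leq_trans (sQ 0)).
(* [Q h].[z h] = 0 reads [z h = \sum_j g j h * z h ^ j]. *)
pose z h := root_fun (x0 + h) - l0.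
have near0 (A : set 'rV[R]_m) : nbhs x0 A -> \forall h \near (0 : 'rV[R]_m), A (x0 + h).
  by move=> /nbhs0P.
have [||||c cP] := @fixed_point_power_series n g z pg.
- rewrite /g /= (_ : (Q 0)`_0 = 0) ?mul0r ?oppr0//.
  rewrite -horner_coef0 /Q addr0 horner_comp !hornerE.
  by have /rootP := nbhs_singleton rP.
- by rewrite /g /= divff// subrr.
- move=> e e0; have /cvgrPdist_le/(_ e e0)/near0 := cf.
  by apply: filterS => h; rewrite distrC.
- near=> h.
  have : (Q h).[z h] = 0.
    rewrite horner_comp !hornerE /z subrK; apply/rootP.
    by near: h; exact: (near0 _ rP).
  rewrite (horner_coef_wide _ (sQ h)) => Qz.
  have -> : \sum_(j < n) g j h * z h ^+ j = z h - e1^-1 * \sum_(i < n) (Q h)`_i * z h ^+ i.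
    rewrite mulr_sumr -[X in X - _](_ : \sum_(j < n) (j == 1%N :> nat)%:R * z h ^+ j = _).
      rewrite -sumrB; apply: eq_bigr => j _; rewrite /g mulrA -mulrBl; congr (_ * _).
      by case: eqP => [->|_]; rewrite ?sub0r mulrC.
    rewrite (bigD1 (Ordinal n2))//= mul1r expr1 big1 ?addr0// => j.
    by rewrite -val_eqE /= => /negPf ->; rewrite mul0r.
  by rewrite Qz mulr0 subr0.
exists (fun alpha => c alpha + (if alpha == [ffun=> 0%N] then l0 else 0)).
near=> h.
have ch : (fun A : {fset multiindex} => \sum_(alpha <- A) c alpha * monomial h alpha)
      @ summability.totally --> z h by near: h.
have FF := @summability.totally_filter multiindex.
rewrite (_ : root_fun _ = z h + l0); last by rewrite /z subrK.
apply: cvg_trans (cvgD ch (cvg_cst l0)); apply: near_eq_cvg.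
exists [fset [ffun=> 0%N]]%fset => // A /= /fsubsetP A0.
rewrite [RHS](_ : _ = \sum_(alpha <- A)
    (c alpha * monomial h alpha + (if alpha == [ffun=> 0%N] then l0 else 0))); last first.
  apply: eq_bigr => alpha _; rewrite mulrDl; congr (_ + _).
  case: eqP => [->|_]; rewrite ?mul0r// big1 ?mulr1// => i _.
  by rewrite ffunE expr0.
rewrite big_split /=; congr (_ + _).
rewrite (bigD1_seq [ffun=> 0%N]) ?fset_uniq//=; last by apply: A0; rewrite inE.
by rewrite eqxx big1 ?addr0// => alpha /negPf ->.
Unshelve. all: by end_near. Qed.

End PowerSeries.

(** * The tridiagonal matrix and its eigenvectors *)

Section Jacobi.
Variables (R : realType) (N : nat).
Local Notation p := ((2 * N).+1).
Implicit Types (a b x : R) (v w : 'rV[R]_p) (psi : nat -> R).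

(** Numbering from 0 moves the couplings [a] to the even positions. *)
Definition offdiag a (i : nat) : R := if odd i then 1 else a.

Lemma offdiag_even a n : offdiag a n.*2 = a.
Proof. by rewrite /offdiag odd_double. Qed.

Lemma offdiag_odd a n : offdiag a n.*2.+1 = 1.
Proof. by rewrite /offdiag /= odd_double. Qed.

Lemma J_sym a v : (J a v)^T = J a v.
Proof.
apply/matrixP => i j; rewrite !mxE eq_sym minnC [(j.+1 == i) || _]orbC.
by case: eqP => // ->.
Qed.

(** A total function on [nat], so that recurrences need no bounds; its values
    from [p] on are junk. *)
Definition entry v (j : nat) : R := v 0 (inord j).

Lemma entryE v (j : 'I_p) : entry v j = v 0 j.
Proof. by rewrite /entry inord_val. Qed.

(** With [psi p = 0] the last column obeys the same three-term rule as the inner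
    ones. *)
Lemma mulmx_J a v psi (j : 'I_p) : psi p = 0 ->
  ((\row_(i < p) psi i) *m J a v) 0 j =
    (if (j : nat) is i.+1 then offdiag a i * psi i else 0)
    + v 0 j * psi j + offdiag a j * psi j.+1.
Proof.
move=> psip; rewrite mxE.
under eq_bigr => i _.
  rewrite !mxE (_ : _ * _ =
    (if (i.+1 == j)%N then offdiag a i * psi i else 0)
    + (if (i == j :> nat) then v 0 j * psi i else 0)
    + (if (i == j.+1 :> nat) then offdiag a j * psi i else 0)); last first.
    rewrite /offdiag -val_eqE /= [j.+1 == _]eq_sym.
    case: (ltngtP i j) => ij /=.
    - have -> : (i == j.+1 :> nat) = false by lia.
      by case: eqP => _; rewrite /= !addr0 ?mulr0// mulrC.
    - have -> : (i.+1 == j :> nat) = false by lia.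
      by case: eqP => _; rewrite /= !add0r ?mulr0// mulrC.
    - have -> : i = j by exact: val_inj.
      have -> : (j.+1 == j :> nat) = false by lia.
      have -> : (j == j.+1 :> nat) = false by lia.
      by rewrite add0r addr0 mulrC.
  over.
rewrite !big_split /= -!big_mkcond /=.
rewrite (big_ord1_eq _ (fun i => v 0 j * psi i)) ltn_ord.
rewrite (big_ord1_eq _ (fun i => offdiag a j * psi i)).
congr (_ + _ + _).
  case: (nat_of_ord j) (ltn_ord j) => [|k] kp; first by rewrite big_pred0.
  rewrite (eq_bigl (fun i : 'I_p => i == k :> nat)) => [|i]; last by rewrite eqSS.
  by rewrite (big_ord1_eq _ (fun i => offdiag a i * psi i)) ltnW.
case: ltnP => // pj.
by rewrite (_ : j.+1 = p) ?psip ?mulr0//; apply/eqP; rewrite eqn_leq pj ltn_ord.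
Qed.

Lemma eigen_recurrence a v x psi : psi p = 0 ->
  (forall j, (j < p)%N ->
     (if j is i.+1 then offdiag a i * psi i else 0)
     + entry v j * psi j + offdiag a j * psi j.+1 = x * psi j) ->
  (\row_(i < p) psi i) *m J a v = x *: \row_(i < p) psi i.
Proof.
move=> psip psiE; apply/rowP => j; rewrite mulmx_J// !mxE -psiE//.
by rewrite entryE.
Qed.

(** The candidate eigenvector of [J a v] for the eigenvalue [x], normalized by
    its first entry. *)
Fixpoint phi a v x (j : nat) : R :=
  if j is j'.+1 then
    ((x - entry v j') * phi a v x j'
     - (if j' is j''.+1 then offdiag a j'' * phi a v x j'' else 0)) / offdiag a j'
  else 1.

Lemma offdiag_neq0 a j : a != 0 -> offdiag a j != 0.
Proof. by rewrite /offdiag; case: odd => //; rewrite oner_eq0. Qed.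

Lemma phi_recurrence a v x j : a != 0 ->
  (if j is i.+1 then offdiag a i * phi a v x i else 0)
     + entry v j * phi a v x j + offdiag a j * phi a v x j.+1 = x * phi a v x j.
Proof.
move=> a0; rewrite [phi a v x j.+1]/= mulrCA divff ?offdiag_neq0// mulr1.
by case: j => [|i]; ring.
Qed.

(** Solutions of the recurrence form a line because the couplings are
    invertible. *)
Lemma recurrence_phi a v x psi n : a != 0 ->
  (forall j, (j < n)%N ->
     (if j is i.+1 then offdiag a i * psi i else 0)
     + entry v j * psi j + offdiag a j * psi j.+1 = x * psi j) ->
  forall j, (j <= n)%N -> psi j = psi 0%N * phi a v x j.
Proof.
move=> a0 psiE; elim/ltn_ind => -[|j] IH jn; first by rewrite mulr1.
apply: (mulfI (offdiag_neq0 j a0)).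
have e1 := psiE j jn; have e2 := phi_recurrence v x j a0.
rewrite [RHS]mulrCA; have -> : offdiag a j * psi j.+1 =
    x * psi j - (if j is i.+1 then offdiag a i * psi i else 0) - entry v j * psi j.
  by rewrite -e1; case: (j) => [|i]; ring.
have -> : offdiag a j * phi a v x j.+1 = x * phi a v x j
    - (if j is i.+1 then offdiag a i * phi a v x i else 0) - entry v j * phi a v x j.
  by rewrite -e2; case: (j) => [|i]; ring.
rewrite IH//; last exact: ltnW.
case: j {e1 e2} IH jn => [|i] IH jn; first by ring.
by rewrite (IH i)//; [ring|exact: ltnW (ltnW jn)].
Qed.

Lemma eigenvector_phi a v x (u : 'rV[R]_p) : a != 0 -> u *m J a v = x *: u ->
  u = u 0 0 *: (\row_(i < p) phi a v x i) /\ (u != 0 -> phi a v x p = 0).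
Proof.
move=> a0 uJ; pose psi j := if (j < p)%N then entry u j else 0.
have psip : psi p = 0 by rewrite /psi ltnn.
have upsi : u = \row_(i < p) psi i.
  by apply/rowP => i; rewrite !mxE /psi ltn_ord entryE.
have psiE j : (j < p)%N -> (if j is i.+1 then offdiag a i * psi i else 0)
     + entry v j * psi j + offdiag a j * psi j.+1 = x * psi j.
  move=> jp; have /rowP/(_ (Ordinal jp)) := uJ.
  by rewrite {1 2}upsi mulmx_J// !mxE -entryE.
have phiE := recurrence_phi a0 psiE.
have u0 : u 0 0 = psi 0%N by rewrite /psi /= -entryE.
split.
  by apply/rowP => i; rewrite [in LHS]upsi !mxE u0 phiE// ltnW.
move=> un0; have := phiE p (leqnn _); rewrite psip => /esym/eqP.
rewrite mulf_eq0 => /orP[/eqP psi0|/eqP//].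
case/eqP: un0; apply/rowP => i; rewrite [in LHS]upsi !mxE.
by rewrite phiE ?psi0 ?mul0r// ltnW.
Qed.

(** That [x] is an eigenvalue is needed only at the last row, where it says that
    [phi] vanishes at [p]. *)
Lemma eigenvalue_phi a v x : a != 0 -> root (char_poly (J a v)) x ->
  (\row_(i < p) phi a v x i) *m J a v = x *: \row_(i < p) phi a v x i.
Proof.
move=> a0; rewrite -eigenvalue_root_char => /eigenvalueP[u uJ un0].
have [_ /(_ un0) phip] := eigenvector_phi a0 uJ.
by apply: eigen_recurrence => // j _; exact: phi_recurrence.
Qed.

(** * Regularity of the ordered eigenvalues *)

Definition eigval (i : nat) a v : R := nth 0 (ordered_eigenvalues (J a v)) i.

Lemma lambdaE (k : int) a v : lambda k a v = eigval (absz (k + N%:Z)) a v.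
Proof. by []. Qed.

Lemma eigval_root (i : 'I_p) a v : root (char_poly (J a v)) (eigval i a v).
Proof.
have [_ sz ->] := ordered_eigenvaluesP (J_sym a v).
by rewrite root_prod_XsubC mem_nth// sz.
Qed.

Lemma eigval_inj a v : a != 0 -> forall i j : 'I_p, eigval i a v = eigval j a v -> i = j.
Proof.
move=> a0 i j; have [_ sz _] := ordered_eigenvaluesP (J_sym a v).
have /(uniqP 0) : uniq (ordered_eigenvalues (J a v)).
  apply: uniq_ordered_eigenvalues; first exact: J_sym.
  by move=> x u uJ u0; have [-> _] := eigenvector_phi a0 uJ; rewrite u0 scale0r.
by move=> /(_ i j); rewrite !inE sz !ltn_ord => h /h => /(_ isT isT)/val_inj.
Qed.

(** The entries of the matrix depend on the parameters with constant [1]; the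
    factor [p] comes from bounding the operator norm by the entries. *)
Lemma eigval_lip (i : 'I_p) a b v w :
  `|eigval i a v - eigval i b w| <= p%:R * (`|a - b| + `|v - w|).
Proof.
apply: eigenvalue_perturb; [exact: J_sym|exact: J_sym|move=> k l].
have vw0 : 0 <= `|v - w| := normr_ge0 _.
have ab0 : 0 <= `|a - b| := normr_ge0 _.
rewrite !mxE; case: eqP => _.
  by have := row_coord_le (v - w) k; rewrite !mxE; lra.
case: ifP => _; last by rewrite subrr normr0; lra.
by case: odd; rewrite ?subrr ?normr0; lra.
Qed.

Lemma eigval_continuous (i : 'I_p) (x0 : 'rV[R]_(1 + p)) :
  {for x0, continuous (fun x : 'rV[R]_(1 + p) => eigval i (lsubmx x 0 0) (rsubmx x))}.
Proof.
have FF : Filter (nbhs x0) by exact: nbhs_filter.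
apply: (proj2 (@cvgrPdist_le _ _ _ (nbhs x0) FF _ _)) => e e0.
have e0' : 0 < e / (p%:R * 2) by rewrite divr_gt0// mulr_gt0// ltr0n.
apply: (proj2 (nbhs0P _ x0)); have := @nbhs0_le _ 'rV[R]_(1 + p) _ e0'; apply: filterS => h he.
apply: le_trans (eigval_lip _ _ _ _ _) _.
rewrite -ler_pdivlMl ?ltr0n//.
have h0 : `|h 0 (lshift p 0)| <= `|h| by exact: row_coord_le.
have hr : `|rsubmx h| <= `|h|.
  rewrite [leLHS]/Num.norm /= mx_normrE; apply/bigmax_leP; split=> // -[k l] _.
  by rewrite mxE (ord1 k); exact: row_coord_le.
have -> : rsubmx x0 - rsubmx (x0 + h) = - rsubmx h.
  by apply/matrixP => k l; rewrite !mxE opprD addrA subrr add0r.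
have -> : lsubmx x0 0 0 - lsubmx (x0 + h) 0 0 = - h 0 (lshift p 0).
  by rewrite !mxE opprD addrA subrr add0r.
rewrite !normrN; apply: (@le_trans _ _ (2 * `|h|)); first lra.
by rewrite -ler_pdivlMl//; apply: le_trans he _; rewrite le_eqVlt; apply/orP; left; apply/eqP; field; rewrite ?pnatr_eq0.
Qed.

(** The derivative of the characteristic polynomial at an eigenvalue is the
    product of the differences with the other ones. *)
Lemma eigval_simple (i : 'I_p) a v :
  (forall j : 'I_p, j != i -> eigval j a v != eigval i a v) ->
  ~~ root (char_poly (J a v))^`() (eigval i a v).
Proof.
have [_ sz ->] := ordered_eigenvaluesP (J_sym a v); rewrite /eigval => neq.
set s := ordered_eigenvalues _ in sz neq *; set l := nth 0 s i.
have i_s : (i < size s)%N by rewrite sz.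
rewrite -(cat_take_drop i s) (drop_nth 0)// big_cat big_cons /= mulrCA.
rewrite derivM derivXsubC mul1r /root !hornerE subrr mul0r addr0.
rewrite mulf_eq0 negb_or -!/(root _ _) !root_prod_XsubC.
apply/andP; split; apply/negP => /(nthP 0)[j].
  rewrite size_take i_s => ji; rewrite nth_take// => jl.
  have jp : (j < p)%N by exact: ltn_trans ji (ltn_ord i).
  have := neq (Ordinal jp); rewrite -val_eqE /= jl eqxx ltn_eqF// => /(_ isT).
  by [].
rewrite size_drop sz => ji; rewrite nth_drop => jl.
have jp : (i.+1 + j < p)%N by lia.
have := neq (Ordinal jp); rewrite -val_eqE /= jl eqxx gtn_eqF; last by lia.
by move=> /(_ isT).
Qed.

Section PolyCoef.
Variable m : nat.
Implicit Types F G : 'rV[R]_m -> {poly R}.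

(** The parameter-dependent polynomials to which [simple_root_analytic] applies;
    they are closed under ring operations, hence under determinants. *)
Definition poly_coefs F := forall j, poly_fun (fun h => (F h)`_j).

Lemma poly_coefs_const q : poly_coefs (fun=> q).
Proof. by move=> j; exact: poly_fun_const. Qed.

Lemma poly_coefsM F G : poly_coefs F -> poly_coefs G -> poly_coefs (fun h => F h * G h).
Proof.
move=> pF pG j.
apply: (@poly_fun_ext _ _ (fun h => \sum_(i < j.+1) (F h)`_i * (G h)`_(j - i))).
  by move=> h; rewrite coefM.
by apply: poly_fun_sum => i; exact: poly_funM.
Qed.

Lemma poly_coefs_sum (I : Type) (s : seq I) (F : I -> 'rV[R]_m -> {poly R}) :
  (forall i, poly_coefs (F i)) -> poly_coefs (fun h => \sum_(i <- s) F i h).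
Proof.
move=> pF j; apply: (@poly_fun_ext _ _ (fun h => \sum_(i <- s) (F i h)`_j)).
  by move=> h; rewrite coef_sum.
by apply: poly_fun_sum => i; exact: pF.
Qed.

Lemma poly_coefs_prod (I : Type) (s : seq I) (F : I -> 'rV[R]_m -> {poly R}) :
  (forall i, poly_coefs (F i)) -> poly_coefs (fun h => \prod_(i <- s) F i h).
Proof.
move=> pF; elim: s => [|i s IH] j.
  by apply: poly_fun_ext (poly_coefs_const 1 j) => h; rewrite big_nil.
by apply: poly_fun_ext (poly_coefsM (pF i) IH j) => h; rewrite big_cons.
Qed.

Lemma poly_coefs_char_poly n (A : 'rV[R]_m -> 'M[R]_n) :
  (forall i j, poly_fun (fun h => A h i j)) -> poly_coefs (fun h => char_poly (A h)).
Proof.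
move=> pA; apply: poly_coefs_sum => s; apply: poly_coefsM.
  exact: poly_coefs_const.
apply: poly_coefs_prod => i j.
apply: (@poly_fun_ext _ _ (fun h => ('X *+ (i == s i) : {poly R})`_j
    + (if j == 0%N then -1 else 0) * A h i (s i))).
  move=> h; rewrite !mxE coefB coefC; congr (_ + _).
  by case: eqP => _; rewrite ?mulN1r// mul0r oppr0.
apply: poly_funD; first exact: poly_fun_const.
by apply: poly_funM; first exact: poly_fun_const.
Qed.

End PolyCoef.

Lemma poly_fun_J (x0 : 'rV[R]_(1 + p)) (i j : 'I_p) :
  poly_fun (fun h => J (lsubmx (x0 + h) 0 0) (rsubmx (x0 + h)) i j).
Proof.
have pc k : poly_fun (fun h : 'rV[R]_(1 + p) => (x0 + h) 0 k).
  have := poly_funD (@poly_fun_const R (1 + p) (x0 0 k)) (poly_fun_coord R k).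
  by apply: poly_fun_ext => h; rewrite mxE.
have [ij|ij] := eqVneq i j.
  by apply: poly_fun_ext (pc (rshift 1 i)) => h; rewrite !mxE ij eqxx.
have [adj|nadj] := boolP ((i.+1 == j)%N || (j.+1 == i)%N); last first.
  by apply: poly_fun_ext (@poly_fun_const R (1 + p) 0) => h; rewrite !mxE (negPf ij) (negPf nadj).
have [odd_ij|even_ij] := boolP (odd (minn i j)).
  by apply: poly_fun_ext (@poly_fun_const R (1 + p) 1) => h; rewrite !mxE (negPf ij) adj odd_ij.
apply: poly_fun_ext (pc (lshift p 0)) => h.
by rewrite !mxE (negPf ij) adj (negPf even_ij).
Qed.

Lemma eigval_analytic (i : 'I_p) (x0 : 'rV[R]_(1 + p)) :
  (forall j : 'I_p, j != i ->
     eigval j (lsubmx x0 0 0) (rsubmx x0) != eigval i (lsubmx x0 0 0) (rsubmx x0)) ->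
  real_analytic_at (fun x : 'rV[R]_(1 + p) => eigval i (lsubmx x 0 0) (rsubmx x)) x0.
Proof.
move=> neq.
apply: (@simple_root_analytic _ _ p.+1
  (fun x : 'rV[R]_(1 + p) => char_poly (J (lsubmx x 0 0) (rsubmx x)))).
- by move=> x; rewrite size_char_poly.
- by apply: poly_coefs_char_poly => k l; exact: poly_fun_J.
- exact: eigval_continuous.
- by apply: (@filterE _ (nbhs x0)) => x; exact: eigval_root.
- exact: eigval_simple.
Qed.

(** * The unperturbed spectrum *)

Local Notation c_ := (c_ R N).
Local Notation s_ := (s_ R N).
Implicit Type k : int.

Let theta : R := pi / N.+1%:R.

Let cE k : c_ k = cos (k%:~R * theta). Proof. by rewrite /c_ mulrA. Qed.
Let sE k : s_ k = sin (k%:~R * theta). Proof. by rewrite /s_ mulrA. Qed.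

Lemma c_s_sq k : c_ k ^+ 2 + s_ k ^+ 2 = 1.
Proof. by rewrite cE sE cos2Dsin2. Qed.

Lemma c_N k : c_ (- k) = c_ k.
Proof. by rewrite !cE mulrNz mulNr cosN. Qed.

Lemma s_N k : s_ (- k) = - s_ k.
Proof. by rewrite !sE mulrNz mulNr sinN. Qed.

Lemma s_0 : s_ 0 = 0. Proof. by rewrite sE mul0r sin0. Qed.

Lemma s_D j k : s_ (j + k) = s_ j * c_ k + c_ j * s_ k.
Proof. by rewrite !cE !sE intrD mulrDl sinD. Qed.

Lemma s_full k : s_ (N.+1%:Z * k) = 0.
Proof.
have spi (n : nat) : sin (n%:R * pi : R) = 0.
  elim: n => [|n IH]; first by rewrite mul0r sin0.
  by rewrite -natr1 mulrDl mul1r sinDpi IH oppr0.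
rewrite sE intrM mulrAC /theta mulrCA divff ?pnatr_eq0// mulr1 mulrC.
case: k => n; first exact: spi.
by rewrite NegzE mulrNz mulNr sinN spi oppr0.
Qed.

Let theta_range (n : nat) : (n <= N)%N -> 0 <= n%:R * theta < pi.
Proof.
move=> nN; have pi0 := pi_gt0 R.
rewrite mulr_ge0 ?divr_ge0 ?(ltW pi0)//= mulrA ltr_pdivrMr ?ltr0n//.
by rewrite mulrC ltr_pM2l// ltr_nat.
Qed.

Lemma s_gt0 (n : nat) : (0 < n <= N)%N -> 0 < s_ n.
Proof.
move=> /andP[n0 nN]; rewrite sE sin_gt0_pi//.
have /andP[_ ->] := theta_range nN.
by rewrite !mulr_gt0 ?divr_gt0 ?pi_gt0 ?ltr0n.
Qed.

Lemma c_decr (m n : nat) : (m < n <= N)%N -> c_ n < c_ m.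
Proof.
move=> /andP[mn nN]; rewrite !cE ltr_cos.
- by rewrite ltr_pM2r ?ltr_nat// divr_gt0 ?pi_gt0 ?ltr0n.
- by rewrite in_itv /=; have /andP[-> /ltW ->] := theta_range (leq_trans (ltnW mn) nN).
- by rewrite in_itv /=; have /andP[-> /ltW ->] := theta_range nN.
Qed.

(** The dispersion relation: the square of the unperturbed eigenvalue. *)
Definition disp k a : R := 1 + a ^+ 2 - 2 * a * c_ k.

(** In this form the minimum over [a] and its positivity are visible. *)
Lemma dispE k a : disp k a = s_ k ^+ 2 + (a - c_ k) ^+ 2.
Proof.
transitivity (c_ k ^+ 2 + s_ k ^+ 2 + a ^+ 2 - 2 * a * c_ k); last by ring.
by rewrite c_s_sq.
Qed.

Definition lambda0 k a : R := (Num.sg k)%:~R * Num.sqrt (disp k a).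

Lemma s_neq0 k : k != 0 -> (`|k| <= N)%N -> s_ k != 0.
Proof.
by case: k => [[|n]|n] //= _ nN; rewrite ?NegzE ?s_N ?oppr_eq0 gt_eqF// s_gt0.
Qed.

Lemma disp_gt0 k a : k != 0 -> (`|k| <= N)%N -> 0 < disp k a.
Proof.
move=> k0 kN; rewrite dispE ltr_pwDl ?sqr_ge0// lt_neqAle sqr_ge0 andbT eq_sym.
by rewrite sqrf_eq0 s_neq0.
Qed.

Lemma sgz_sqr k : k != 0 -> (Num.sg k)%:~R * (Num.sg k)%:~R = 1 :> R.
Proof.
by move=> k0; rewrite -intrM -expr2 sqr_sg k0.
Qed.

Lemma lambda0_sqr k a : k != 0 -> (`|k| <= N)%N -> lambda0 k a ^+ 2 = disp k a.
Proof.
move=> k0 kN; rewrite /lambda0 exprMn sqr_sqrtr ?ltW ?disp_gt0//.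
by rewrite expr2 sgz_sqr// mul1r.
Qed.

Lemma lambda0_neq0 k a : k != 0 -> (`|k| <= N)%N -> lambda0 k a != 0.
Proof.
by move=> k0 kN; rewrite -sqrf_eq0 lambda0_sqr// gt_eqF// disp_gt0.
Qed.

(** On the odd positions (counting from 0) the square of the matrix is a discrete
    Laplacian, diagonalized by sine waves; the eigenvalue equation then gives
    the even positions.  For [a > 0] the alternating sign makes the eigenvalue
    increase with [|k|]. *)
Definition psi0 k a (i : nat) : R :=
  let n := i./2 in
  (-1) ^+ n.+1 * (if odd i then s_ (n.+1%:Z * k)
                  else (a * s_ (n.+1%:Z * k) - s_ (n%:Z * k)) / lambda0 k a).

Lemma psi0_even k a n : psi0 k a n.*2 =
  (-1) ^+ n.+1 * ((a * s_ (n.+1%:Z * k) - s_ (n%:Z * k)) / lambda0 k a).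
Proof. by rewrite /psi0 odd_double doubleK. Qed.

Lemma psi0_odd k a n : psi0 k a n.*2.+1 = (-1) ^+ n.+1 * s_ (n.+1%:Z * k).
Proof. by rewrite /psi0 /= odd_double /= uphalf_double. Qed.

Lemma psi0_end k a : psi0 k a p = 0.
Proof. by rewrite mul2n psi0_odd s_full mulr0. Qed.

Lemma s_next k (n : nat) : s_ (n.+2%:Z * k) = 2 * c_ k * s_ (n.+1%:Z * k) - s_ (n%:Z * k).
Proof.
have -> : n.+2%:Z * k = n.+1%:Z * k + k by rewrite -[in LHS]addn1 PoszD mulrDl mul1r.
have -> : n%:Z * k = n.+1%:Z * k - k by rewrite -[in RHS]addn1 PoszD mulrDl mul1r addrK.
by rewrite !s_D c_N s_N; ring.
Qed.

Lemma psi0_recurrence k a j : k != 0 -> (`|k| <= N)%N ->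
  (if j is i.+1 then offdiag a i * psi0 k a i else 0)
    + entry 0 j * psi0 k a j + offdiag a j * psi0 k a j.+1 = lambda0 k a * psi0 k a j.
Proof.
move=> k0 kN; have l0 := lambda0_neq0 a k0 kN; have l2 := lambda0_sqr a k0 kN.
rewrite /entry mxE mul0r addr0 -(odd_double_half j).
case: (odd j) (j./2) => n; rewrite ?add0n ?add1n.
  rewrite psi0_odd -doubleS !psi0_even offdiag_even offdiag_odd mul1r.
  rewrite s_next; apply: (mulfI l0); rewrite [RHS]mulrA -expr2 l2 /disp.
  by rewrite [(-1) ^+ n.+2]exprS; field.
rewrite psi0_odd psi0_even.
rewrite [RHS](_ : _ = (-1) ^+ n.+1 * (a * s_ (n.+1%:Z * k) - s_ (n%:Z * k))); last by field.
rewrite offdiag_even; case: n => [|n]; first by rewrite mul0r s_0 /=; ring.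
rewrite -[X in X + _]/(offdiag a n.*2.+1 * psi0 k a n.*2.+1) offdiag_odd psi0_odd.
by rewrite [(-1) ^+ n.+2]exprS; ring.
Qed.

(** For [k = 0] the eigenvector is supported on the even positions, where it is
    geometric with ratio [- a]. *)
Lemma lambda0_root k a : (`|k| <= N)%N -> root (char_poly (J (N := N) a 0)) (lambda0 k a).
Proof.
move=> kN; rewrite -eigenvalue_root_char; apply/eigenvalueP.
have [->|k0] := eqVneq k 0.
  pose psi j : R := if odd j then 0 else (- a) ^+ j./2.
  exists (\row_(i < p) psi i).
    rewrite (eigen_recurrence (x := lambda0 0 a))//.
      by rewrite /psi /= mul2n odd_double.
    move=> j _; rewrite /lambda0 sgr0 mul0r mul0r /entry mxE mul0r addr0.
    rewrite /offdiag /psi; case: j => [|j] /=; first by rewrite mulr0 addr0.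
    case: (boolP (odd j)) => [oj|ej] /=; first by rewrite !mulr0 addr0.
    by rewrite exprS; ring.
  by apply/eqP => /rowP/(_ 0); rewrite !mxE /psi /= expr0 => /eqP; rewrite oner_eq0.
exists (\row_(i < p) psi0 k a i).
  by apply: eigen_recurrence; [exact: psi0_end|move=> j _; exact: psi0_recurrence].
have p1 : (1 < p)%N by lia.
apply/eqP => /rowP/(_ (Ordinal p1)); rewrite !mxE /psi0 /= expr1 mul1r => /eqP.
by rewrite mulN1r oppr_eq0 (negPf (s_neq0 k0 kN)).
Qed.

Lemma lambda0_mono j k a : 0 < a -> (`|j| <= N)%N -> (`|k| <= N)%N -> j < k ->
  lambda0 j a < lambda0 k a.
Proof.
move=> a0 jN kN jk.
have nonneg (m n : nat) : (m < n <= N)%N -> lambda0 m a < lambda0 n a.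
  move=> mn; rewrite /lambda0.
  have n0 : (n : int) != 0 by lia.
  rewrite (gtr0_sg (x := n%:Z)) ?mul1r; last by lia.
  case: m mn => [|m] mn; first by rewrite sgr0 mul0r sqrtr_gt0 disp_gt0//; lia.
  rewrite gtr0_sg// mul1r ltr_sqrt ?disp_gt0//; last by lia.
  by rewrite /disp ltrD2l ltrN2 ltr_pM2l ?c_decr// mulr_gt0.
have oppE n : lambda0 (- n) a = - lambda0 n a.
  by rewrite /lambda0 sgrN mulrNz mulNr /disp c_N.
case: j k jN kN jk => [m|m] [n|n] //= jN kN jk.
- by apply: nonneg; lia.
- apply: (@lt_le_trans _ _ 0).
    by rewrite NegzE oppE oppr_lt0 -[ltLHS](_ : lambda0 0 a = _) ?nonneg ?/lambda0 ?sgr0 ?mul0r.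
  by rewrite /lambda0 mulr_ge0 ?sqrtr_ge0// ler0z sgr_ge0.
- by rewrite !NegzE !oppE ltrN2; apply: nonneg; lia.
Qed.

(** The numbers [lambda0 k a] are [p] distinct eigenvalues, increasing in [k], so
    they are the whole spectrum in order. *)
Lemma lambda_unperturbed k a : 0 < a -> (`|k| <= N)%N -> lambda (N := N) k a 0 = lambda0 k a.
Proof.
move=> a0 kN.
pose s := [seq lambda0 (i%:Z - N%:Z) a | i <- iota 0 p].
have nth_s i : (i < p)%N -> nth 0 s i = lambda0 (i%:Z - N%:Z) a.
  by move=> ip; rewrite (nth_map 0%N) ?size_iota// nth_iota.
have szs : size s = p by rewrite size_map size_iota.
have mono i j : (i < j < p)%N -> nth 0 s i < nth 0 s j.
  move=> ijp; rewrite !nth_s; try lia.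
  by apply: lambda0_mono => //; lia.
have ss : sorted <%R s.
  by apply/(sortedP 0) => i; rewrite szs => ip; apply: mono; lia.
have sE' : ordered_eigenvalues (J (N := N) a 0) = s.
  apply: ordered_eigenvaluesE; first by move: ss; rewrite lt_sorted_uniq_le => /andP[].
  rewrite -[RHS]scale1r -(monicP (char_poly_monic (J (N := N) a 0))).
  apply: all_roots_prod_XsubC.
  - by rewrite size_char_poly szs.
  - apply/allP => x /(nthP 0)[i]; rewrite szs => ip <-; rewrite nth_s//.
    by apply: lambda0_root; lia.
  - by rewrite uniq_rootsE; exact: lt_sorted_uniq.
rewrite lambdaE /eigval sE' nth_s; last by lia.
by congr lambda0; lia.
Qed.

End Jacobi.

(** * First order perturbation theory *)

Section Perturbation.
Variables (R : realType) (N : nat).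
Local Notation p := ((2 * N).+1).
Local Notation c_ := (c_ R N).
Local Notation s_ := (s_ R N).
Implicit Types (a b x y : R) (v w : 'rV[R]_p) (k : int).

Definition dot (f g : nat -> R) : R := \sum_(i < p) f i * g i.

Lemma row_dot (f g : nat -> R) :
  ((\row_(i < p) f i) *m (\row_(i < p) g i)^T) 0 0 = dot f g.
Proof. by rewrite mxE; apply: eq_bigr => i _; rewrite !mxE. Qed.

(** Eigenvectors of two symmetric matrices see the difference of the
    eigenvalues through the difference of the matrices. *)
Lemma eigenvector_pairing n (A B : 'M[R]_n) x y (u w : 'rV[R]_n) :
  B^T = B -> u *m A = x *: u -> w *m B = y *: w ->
  (x - y) * (u *m w^T) 0 0 = (u *m (A - B) *m w^T) 0 0.
Proof.
move=> sB uA wB.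
have Bw : B *m w^T = y *: w^T by rewrite -{1}sB -trmx_mul wB linearZ.
rewrite mulmxBr mulmxBl uA -[u *m B *m _]mulmxA Bw -scalemxAl -scalemxAr !mxE.
by rewrite mulrBl.
Qed.

(** [phi] is built by field operations, so it inherits any regularity of its
    arguments which is preserved by them. *)
Lemma phi_closed (Q : (R -> 'rV[R]_p -> R) -> Prop) (w : R -> 'rV[R]_p -> 'rV[R]_p)
    (g : R -> 'rV[R]_p -> R) (j : nat) :
  (forall c, Q (fun _ _ => c)) ->
  (forall f h, Q f -> Q h -> Q (fun a v => f a v + h a v)) ->
  (forall f h, Q f -> Q h -> Q (fun a v => f a v * h a v)) ->
  (forall f, (forall a v, 0 < a -> f a v != 0) -> Q f -> Q (fun a v => (f a v)^-1)) ->
  Q (fun a _ => a) -> (forall i, Q (fun a v => entry (w a v) i)) -> Q g ->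
  Q (fun a v => phi a (w a v) (g a v) j).
Proof.
move=> Qc QD QM QV Qa Qw Qg.
have QN f : Q f -> Q (fun a v => - f a v).
  move=> /(QM _ _ (Qc (-1))); congr Q.
  by apply/funext => a; apply/funext => v; rewrite mulN1r.
have Qo i : Q (fun a _ => offdiag a i) by rewrite /offdiag; case: odd.
elim/ltn_ind: j => -[|j] IH; first exact: Qc.
apply: (QM); last by apply: QV => // a v a_gt0; rewrite offdiag_neq0// lt0r_neq0.
apply: (QD); first by apply: (QM); [apply: (QD) => //; exact: QN|exact: IH].
by apply: QN; case: j IH => [|j] IH //; apply: (QM) => //; exact: IH.
Qed.

Section Lipschitz.
Variable a0 : R.
Implicit Types f g : R -> 'rV[R]_p -> R.

Definition base_dist a v : R := `|a - a0| + `|v|.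

Lemma base_dist_ge0 a v : 0 <= base_dist a v. Proof. by rewrite addr_ge0. Qed.

(** Comparison with the value at the base point is enough for [first_order], and
    this class is closed under field operations, so it contains the entries of
    eigenvectors. *)
Definition lip_at f := exists2 C, 0 <= C &
  \forall e \near 0^'+, forall a v, base_dist a v <= e -> `|f a v - f a0 0| <= C * base_dist a v.

Lemma lip_cst c : lip_at (fun _ _ => c).
Proof.
by exists 0 => //; near=> e => a v _; rewrite subrr normr0 mul0r.
Unshelve. all: by end_near. Qed.

Lemma lip_global f C : 0 <= C -> (forall a v, `|f a v - f a0 0| <= C * base_dist a v) -> lip_at f.
Proof. by move=> C0 fC; exists C => //; near=> e => a v _; exact: fC.
Unshelve. all: by end_near. Qed.

Lemma lipD f g : lip_at f -> lip_at g -> lip_at (fun a v => f a v + g a v).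
Proof.
move=> [C C0 fC] [D D0 gD]; exists (C + D); first exact: addr_ge0.
apply: filterS2 fC gD => e fC gD a v he.
have := fC a v he; have := gD a v he => h1 h2.
rewrite (_ : _ - _ = (f a v - f a0 0) + (g a v - g a0 0)); last by ring.
by apply: le_trans (ler_normD _ _) _; rewrite mulrDl; lra.
Qed.

Lemma lipM f g : lip_at f -> lip_at g -> lip_at (fun a v => f a v * g a v).
Proof.
move=> [C C0 fC] [D D0 gD].
exists ((`|f a0 0| + C) * D + `|g a0 0| * C).
  by rewrite addr_ge0 ?mulr_ge0// addr_ge0.
have e1 : \forall e \near (0 : R)^'+, e <= 1 by exact: nbhs_right_le.
apply: filterS3 fC gD e1 => e fC gD e1 a v he.
have hf := fC a v he; have hg := gD a v he.
have d0 := base_dist_ge0 a v.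
rewrite (_ : _ - _ = f a v * (g a v - g a0 0) + g a0 0 * (f a v - f a0 0)); last by ring.
apply: le_trans (ler_normD _ _) _; rewrite !normrM mulrDl; apply: lerD; last first.
  by rewrite -mulrA ler_wpM2l.
rewrite -mulrA; apply: ler_pM => //.
rewrite -[f a v](subrK (f a0 0)) addrC; apply: le_trans (ler_normD _ _) _.
rewrite lerD2l; apply: le_trans hf _.
by rewrite -[leRHS]mulr1 ler_wpM2l// (le_trans he).
Qed.

Lemma lipV f : f a0 0 != 0 -> lip_at f ->
  lip_at (fun a v => (f a v)^-1) /\
  \forall e \near 0^'+, forall a v, base_dist a v <= e -> f a v != 0.
Proof.
move=> f0 [C C0 fC]; set F := f a0 0 in f0 fC.
have F0 : 0 < `|F| by rewrite normr_gt0.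
have e1 : \forall e \near (0 : R)^'+, e <= `|F| / 2 / (C + 1).
  by apply: nbhs_right_le; rewrite !divr_gt0// ltr_wpDl.
have low : \forall e \near (0 : R)^'+, forall a v, base_dist a v <= e -> `|F| / 2 <= `|f a v|.
  apply: filterS2 fC e1 => e fC e1 a v he; have h := fC a v he.
  have : C * base_dist a v <= `|F| / 2.
    have := le_trans he e1; rewrite ler_pdivlMr ?ltr_wpDl// => h2.
    by have := base_dist_ge0 a v; nra.
  have := lerB_normD; have := ler_normD (F - f a v) (f a v).
  by rewrite subrK distrC; lra.
split; last first.
  apply: filterS low => e low a v /low h.
  by rewrite -normr_gt0; apply: lt_le_trans h; rewrite divr_gt0.
exists (2 / `|F| ^+ 2 * C); first by rewrite mulr_ge0// divr_ge0.
apply: filterS2 fC low => e fC low a v he.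
have h := fC a v he; have l := low a v he.
have fn0 : f a v != 0 by rewrite -normr_gt0; apply: lt_le_trans l; rewrite divr_gt0.
rewrite -/F (_ : _ - _ = (F - f a v) / (f a v * F)); last by field; rewrite f0 fn0.
rewrite normrM normfV normrM distrC ler_pdivrMr ?mulr_gt0 ?normr_gt0//.
apply: (le_trans h); rewrite mulrAC -mulrA -[leLHS]mul1r -mulrA.
rewrite [leRHS](_ : _ = 2 / `|F| * `|f a v| * (C * base_dist a v)); last by field; rewrite gt_eqF.
rewrite ler_wpM2r ?mulr_ge0 ?base_dist_ge0//.
by rewrite mulrAC ler_pdivlMr// mul1r; lra.
Qed.

Lemma lip_sum (I : Type) (s : seq I) (F : I -> R -> 'rV[R]_p -> R) :
  (forall i, lip_at (F i)) -> lip_at (fun a v => \sum_(i <- s) F i a v).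
Proof.
move=> lF; elim: s => [|i s [C C0 h]].
  have [C C0 h] := lip_cst 0; exists C => //; apply: filterS h => e h a v he.
  by rewrite !big_nil; exact: h.
have [D D0 g] := lipD (lF i) (ex_intro2 _ _ C C0 h).
by exists D => //; apply: filterS g => e g a v he; rewrite !big_cons; exact: g.
Qed.

Hypothesis a0_gt0 : 0 < a0.

Lemma lip_a : lip_at (fun a _ => a).
Proof. by apply: (lip_global ler01) => a v; rewrite mul1r lerDl. Qed.

Lemma lip_entry j : lip_at (fun _ v => entry v j).
Proof.
apply: (lip_global ler01) => a v; rewrite mul1r /entry [X in _ - X]mxE subr0.
by apply: le_trans (row_coord_le _ _) _; rewrite lerDr.
Qed.

Lemma lip_eigval (i : 'I_p) : lip_at (fun a v => eigval i a v).
Proof.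
apply: (@lip_global _ p%:R) => // a v.
by apply: le_trans (eigval_lip _ _ _ _ _) _; rewrite subr0.
Qed.

Lemma lip_eigval0 (i : 'I_p) : lip_at (fun a _ => eigval (N := N) i a 0).
Proof.
apply: (@lip_global _ p%:R) => // a v.
apply: le_trans (eigval_lip _ _ _ _ _) _.
by rewrite subrr normr0 addr0 ler_wpM2l// lerDl.
Qed.

Lemma lip_phi (w : R -> 'rV[R]_p -> 'rV[R]_p) (g : R -> 'rV[R]_p -> R) j :
  (forall i, lip_at (fun a v => entry (w a v) i)) -> lip_at g ->
  lip_at (fun a v => phi a (w a v) (g a v) j).
Proof.
move=> lw lg; apply: phi_closed => //.
- exact: lip_cst.
- exact: lipD.
- exact: lipM.
- by move=> f f0 lf; have [] := lipV (f0 a0 0 a0_gt0) lf.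
- exact: lip_a.
Qed.

Variable k : int.
Hypothesis k0 : k != 0.
Hypothesis kN : (`|k| <= N)%N.

Let idx_lt : (absz (k + N%:Z)%R < p)%N. Proof. by lia. Qed.
Let idx : 'I_p := Ordinal idx_lt.

Definition first_order_shift v : R :=
  (\sum_(i < p) v 0 i * psi0 N k a0 i ^+ 2) / (\sum_(i < p) psi0 N k a0 i ^+ 2).

(** First order perturbation theory, uniformly in [a] near [a0].  The pairing of
    the perturbed eigenvector at [(a, v)] with the unperturbed one at [(a, 0)]
    gives an exact formula, in which both can be replaced by the unperturbed one
    at [(a0, 0)] because they depend on [(a, v)] in a Lipschitz way. *)
Lemma first_order : exists2 C, 0 <= C & \forall e \near 0^'+,
  forall a v, base_dist a v <= e ->
  `|lambda k a v - lambda0 N k a - first_order_shift v| <= C * (`|v| * base_dist a v).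
Proof.
pose u a v j := phi a v (lambda k a v) j.
pose w a (v : 'rV[R]_p) j := phi (N := N) a 0 (lambda (N := N) k a 0) j.
have lu j : lip_at (fun a v => u a v j).
  by apply: (@lip_phi (fun _ v => v)); [exact: lip_entry|exact: (lip_eigval idx)].
have lw j : lip_at (fun a v => w a v j).
  apply: (@lip_phi (fun _ _ => 0)); last exact: (lip_eigval0 idx).
  by move=> i; rewrite /entry; exact: lip_cst.
pose D a v := dot (u a v) (w a v).
have lD : lip_at D by apply: lip_sum => i; exact: (lipM (lu i) (lw i)).
have D0 : D a0 0 != 0.
  rewrite gt_eqF// /D /dot (bigD1 ord0)//= ltr_pwDl ?mul1r//.
  by apply: sumr_ge0 => i _; rewrite -expr2 sqr_ge0.
have [lDV Dn0] := lipV D0 lD.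
pose g (i : 'I_p) a v := u a v i * w a v i / D a v.
have lg i : lip_at (g i) by exact: (lipM (lipM (lu i) (lw i)) lDV).
have lam0 a : 0 < a -> lambda (N := N) k a 0 = lambda0 N k a by move=> ?; exact: lambda_unperturbed.
have g0 (i : 'I_p) : g i a0 0 = psi0 N k a0 i ^+ 2 / \sum_(i < p) psi0 N k a0 i ^+ 2.
  have rec : forall j, (j < p)%N -> _ := fun j _ => psi0_recurrence a0 j k0 kN.
  have psiE := recurrence_phi (lt0r_neq0 a0_gt0) rec.
  have psi00 : psi0 N k a0 0 != 0.
    rewrite /psi0 /= expr1 mulN1r oppr_eq0 mul0r s_0 subr0 mul1r mulf_neq0//.
      by rewrite mulf_neq0 ?s_neq0// lt0r_neq0.
    by rewrite invr_eq0 lambda0_neq0.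
  have uE (j : 'I_p) : u a0 0 j = psi0 N k a0 j / psi0 N k a0 0.
    by rewrite psiE 1?ltnW// mulrC mulKf// /u lam0.
  have wE (j : 'I_p) : w a0 0 j = psi0 N k a0 j / psi0 N k a0 0 by exact: uE.
  rewrite /g /D /dot uE wE.
  under eq_bigr do rewrite uE wE -expr2 exprMn.
  rewrite -mulr_suml; move: (psi0 N k a0 0) psi00 => q q0; rewrite invfM; set T := (\sum_(i < p) _)^-1.
  by rewrite exprVn invrK; field.
have quad (i : 'I_p) : exists C, 0 <= C /\ \forall e \near 0^'+, forall a v, base_dist a v <= e ->
    `|v 0 i * (g i a v - g i a0 0)| <= C * (`|v| * base_dist a v).
  have [C C0 h] := lg i; exists C; split=> //; apply: filterS h => e h a v he.
  rewrite normrM mulrCA; apply: ler_pM => //; first exact: row_coord_le.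
  exact: h.
have /choice[C CP] := quad.
exists (\sum_i C i); first by apply: sumr_ge0 => i _; have [] := CP i.
have allC : \forall e \near 0^'+, forall i a v, base_dist a v <= e ->
    `|v 0 i * (g i a v - g i a0 0)| <= C i * (`|v| * base_dist a v).
  by apply: filter_forall => i; have [] := CP i.
have ea : \forall e \near (0 : R)^'+, e < a0 by exact: nbhs_right_lt.
apply: filterS3 allC Dn0 ea => e allC Dn0 ea a v he.
have apos : 0 < a.
  have : `|a - a0| <= e by apply: le_trans he; rewrite lerDl.
  by rewrite ler_norml => /andP[? _]; lra.
have Dav := Dn0 a v he.
have ueig : (\row_(i < p) u a v i) *m J a v = lambda k a v *: \row_(i < p) u a v i.
  apply: eigenvalue_phi; first exact: lt0r_neq0.
  exact: (eigval_root idx).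
have weig : (\row_(i < p) w a v i) *m J (N := N) a 0 = lambda (N := N) k a 0 *: \row_(i < p) w a v i.
  apply: eigenvalue_phi; first exact: lt0r_neq0.
  exact: (eigval_root idx).
have := eigenvector_pairing (@J_sym R N a 0) ueig weig.
rewrite row_dot (_ : J a v - J (N := N) a 0 = diag_mx v); last first.
  apply/matrixP => i j; rewrite !mxE; case: eqP => [->|_].
    by rewrite subr0 mulr1n.
  by rewrite subrr mulr0n.
rewrite mul_mx_diag mxE -/(D a v) lam0// => /(canRL (mulfK Dav)) ->.
rewrite /first_order_shift !mulr_suml -sumrB.
rewrite (eq_bigr (fun i : 'I_p => v 0 i * (g i a v - g i a0 0))); last first.
  by move=> i _; rewrite !mxE g0 mulrBr /g; congr (_ - _); ring.
apply: le_trans (ler_norm_sum _ _ _) _; apply: ler_sum => i _.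
exact: allC.
Qed.

End Lipschitz.

(** * The second derivative in the coupling *)

Section SecondDerivative.
Implicit Types f g : R -> 'rV[R]_p -> R.

Definition continuous2 f := forall a v, 0 < a ->
  {for ((a, v) : R * 'rV[R]_p), continuous (fun z : R * 'rV[R]_p => f z.1 z.2)}.

(** This class is closed under field operations, so eigenvector entries belong to
    it as soon as the eigenvalue does. *)
Definition C1 f := continuous2 f /\ exists2 g, continuous2 g &
  forall a v, 0 < a -> is_derive a 1 (fun b => f b v) (g a v).

Lemma continuous2_cst c : continuous2 (fun _ _ => c).
Proof. by move=> a v _; exact: cst_continuous. Qed.

Lemma continuous2D f g : continuous2 f -> continuous2 g -> continuous2 (fun a v => f a v + g a v).
Proof. by move=> cf cg a v a0; exact: continuousD (cf a v a0) (cg a v a0). Qed.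

Lemma continuous2M f g : continuous2 f -> continuous2 g -> continuous2 (fun a v => f a v * g a v).
Proof. by move=> cf cg a v a0; exact: continuousM (cf a v a0) (cg a v a0). Qed.

Lemma continuous2V f : (forall a v, 0 < a -> f a v != 0) ->
  continuous2 f -> continuous2 (fun a v => (f a v)^-1).
Proof. by move=> f0 cf a v a0; exact: continuousV (f0 a v a0) (cf a v a0). Qed.

Lemma continuous2_sum (I : Type) (s : seq I) (F : I -> R -> 'rV[R]_p -> R) :
  (forall i, continuous2 (F i)) -> continuous2 (fun a v => \sum_(i <- s) F i a v).
Proof.
move=> cF; elim: s => [|i s IH].
  rewrite (_ : (fun _ _ => _) = fun _ _ => 0); first exact: continuous2_cst.
  by apply/funext => a; apply/funext => v; rewrite big_nil.
rewrite (_ : (fun _ _ => _) = fun a v => F i a v + \sum_(j <- s) F j a v).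
  exact: continuous2D.
by apply/funext => a; apply/funext => v; rewrite big_cons.
Qed.

Lemma C1_cst c : C1 (fun _ _ => c).
Proof.
split; first exact: continuous2_cst.
by exists (fun _ _ => 0) => [|a v _]; [exact: continuous2_cst|exact: is_derive_cst].
Qed.

Lemma C1D f g : C1 f -> C1 g -> C1 (fun a v => f a v + g a v).
Proof.
move=> [cf [f' cf' df]] [cg [g' cg' dg]]; split; first exact: continuous2D.
exists (fun a v => f' a v + g' a v) => [|a v a0]; first exact: continuous2D.
by apply: is_deriveD; [exact: df|exact: dg].
Qed.

Lemma C1M f g : C1 f -> C1 g -> C1 (fun a v => f a v * g a v).
Proof.
move=> [cf [f' cf' df]] [cg [g' cg' dg]]; split; first exact: continuous2M.
exists (fun a v => f a v * g' a v + g a v * f' a v) => [|a v a0].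
  by apply: continuous2D; exact: continuous2M.
by apply: is_deriveM; [exact: df|exact: dg].
Qed.

Lemma C1V f : (forall a v, 0 < a -> f a v != 0) -> C1 f -> C1 (fun a v => (f a v)^-1).
Proof.
move=> f0 [cf [f' cf' df]]; have cV := continuous2V f0 cf; split=> //.
exists (fun a v => -1 * ((f a v)^-1 * (f a v)^-1) * f' a v) => [|a v a0].
  by do 2?[apply: continuous2M => //]; [exact: continuous2_cst|exact: continuous2M].
apply: is_derive_eq (is_deriveV (f0 a v a0) (df a v a0)) _.
by rewrite mulN1r -expr2 exprVn.
Qed.

Lemma C1_sum (I : Type) (s : seq I) (F : I -> R -> 'rV[R]_p -> R) :
  (forall i, C1 (F i)) -> C1 (fun a v => \sum_(i <- s) F i a v).
Proof.
move=> cF; elim: s => [|i s IH].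
  rewrite (_ : (fun _ _ => _) = fun _ _ => 0); first exact: C1_cst.
  by apply/funext => a; apply/funext => v; rewrite big_nil.
rewrite (_ : (fun _ _ => _) = fun a v => F i a v + \sum_(j <- s) F j a v).
  exact: C1D.
by apply/funext => a; apply/funext => v; rewrite big_cons.
Qed.

Lemma continuous2_fst : continuous2 (fun a _ => a).
Proof. by move=> a v _; exact: cvg_fst. Qed.

Lemma continuous2_entry j : continuous2 (fun _ v => entry v j).
Proof.
move=> a v _; apply: (@continuous_comp _ _ _ snd (fun w : 'rV[R]_p => w 0 (inord j))).
  exact: cvg_snd.
exact: coord_continuous.
Qed.

Lemma nbhs_dist_le (V : pseudoMetricNormedZmodType R) (x : V) (e : R) :
  0 < e -> \forall y \near x, `|x - y| <= e.
Proof.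
move=> e0; apply: (proj2 (nbhs0P _ x)); have := @nbhs0_le _ V e e0.
by apply: filterS => h; rewrite opprD addrA subrr sub0r normrN.
Qed.

Lemma continuous2_eigval (i : 'I_p) : continuous2 (eigval i).
Proof.
move=> a v _; apply/cvgrPdist_le => e e0.
have e0' : 0 < e / (p%:R * 2) by rewrite divr_gt0// mulr_gt0// ltr0n.
exists ([set b | `|a - b| <= e / (p%:R * 2)], [set w | `|v - w| <= e / (p%:R * 2)]).
  by split; [exact: (@nbhs_dist_le R^o a)|exact: (@nbhs_dist_le 'rV[R]_p v)].
move=> [b w] /= [hb hw]; apply: le_trans (eigval_lip _ _ _ _ _) _.
rewrite -ler_pdivlMl ?ltr0n//.
apply: le_trans (lerD hb hw) _; rewrite le_eqVlt; apply/orP; left; apply/eqP.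
have : (p%:R : R) != 0 by rewrite pnatr_eq0.
by move: (p%:R : R) => q q0; field.
Qed.

Lemma continuous2_section f a v : continuous2 f -> 0 < a ->
  {for a, continuous (fun b => f b v)}.
Proof.
move=> cf a0; apply: (@continuous_comp _ _ _ (fun b => (b, v)) (fun z => f z.1 z.2)).
  move=> A [[B C] [/= Ba Cv] BC]; apply: filterS Ba => b Bb.
  by apply: BC; split => //=; exact: nbhs_singleton Cv.
exact: cf.
Qed.

Lemma is_derive_quotient (f q : R -> R) a :
  (\forall z \near a, f z - f a = q z * (z - a)) -> {for a, continuous q} ->
  is_derive a 1 f (q a).
Proof.
move=> fq cq; apply/is_derive1_caratheodory.
exists (fun z => if z == a then q a else (f z - f a) / (z - a)); split.
- move=> z; case: eqP => [->|/eqP za]; first by rewrite !subrr mulr0.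
  by rewrite divfK// subr_eq0.
- rewrite /prop_for /continuous_at eqxx; apply: cvg_trans cq; apply: near_eq_cvg.
  apply: filterS fq => z zE; case: eqP => [->//|/eqP za].
  by rewrite zE mulfK// subr_eq0.
- by rewrite eqxx.
Qed.

(** The derivative of an eigenvalue in [a] is the quadratic form of the derivative
    of the matrix at a normalized eigenvector. *)
Lemma C1_eigval_derivative (i : 'I_p) : continuous2 (eigval i) /\
  exists2 g, C1 g & forall a v, 0 < a -> is_derive a 1 (fun b => eigval i b v) (g a v).
Proof.
have cl := @continuous2_eigval i; split=> //.
pose u a v j := phi a v (eigval i a v) j.
pose E : 'M[R]_p := J 1 0 - J 0 0.
pose num (f g : nat -> R) := \sum_(k < p) \sum_(l < p) f k * E k l * g l.
have dot_gt0 a v : 0 < dot (u a v) (u a v).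
  rewrite /dot (bigD1 ord0)//= mul1r ltr_pwDl// sumr_ge0// => k _.
  by rewrite -expr2 sqr_ge0.
have cu j : continuous2 (fun a v => u a v j).
  apply: (@phi_closed continuous2 (fun _ v => v)).
  - exact: continuous2_cst.
  - exact: continuous2D.
  - exact: continuous2M.
  - exact: continuous2V.
  - exact: continuous2_fst.
  - exact: continuous2_entry.
  - exact: cl.
have cnum (f : R -> 'rV[R]_p -> nat -> R) :
    (forall j, continuous2 (fun a v => f a v j)) -> continuous2 (fun a v => num (u a v) (f a v)).
  move=> cf; apply: continuous2_sum => k; apply: continuous2_sum => l; apply: continuous2M => //.
  by apply: continuous2M => //; exact: continuous2_cst.
have cdot (f : R -> 'rV[R]_p -> nat -> R) :
    (forall j, continuous2 (fun a v => f a v j)) -> continuous2 (fun a v => dot (u a v) (f a v)).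
  by move=> cf; apply: continuous2_sum => k; exact: continuous2M.
have dl a v : 0 < a -> is_derive a 1 (fun b => eigval i b v)
    (num (u a v) (u a v) / dot (u a v) (u a v)).
  move=> a0; pose q b := num (u b v) (u a v) / dot (u b v) (u a v).
  have cst_u j : continuous2 (fun _ _ => u a v j) by exact: continuous2_cst.
  have cD := @continuous2_section _ a v (cdot (fun _ _ => u a v) cst_u) a0.
  (* [q] is the difference quotient, by the pairing of the eigenvectors at [b]
     and at [a]. *)
  apply: (@is_derive_quotient _ q).
    have D0 : \forall b \near a, dot (u b v) (u a v) != 0.
      have : \forall b \near a, 0 < dot (u b v) (u a v) by apply: (cvgr_gt _ cD); exact: dot_gt0.
      by apply: filterS => b; exact: lt0r_neq0.
    have pos : \forall b \near a, 0 < b by exact: lt_nbhsr.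
    apply: filterS2 D0 pos => b Db b0.
    have eig c : 0 < c -> (\row_(j < p) u c v j) *m J c v = eigval i c v *: \row_(j < p) u c v j.
      by move=> c0; apply: eigenvalue_phi; [exact: lt0r_neq0|exact: eigval_root].
    have := eigenvector_pairing (@J_sym R N a v) (eig b b0) (eig a a0).
    rewrite row_dot (_ : J b v - J a v = (b - a) *: E); last first.
      apply/matrixP => k l; rewrite !mxE; case: eqP => _; first by rewrite subrr subrr mulr0.
      case: ifP => _; last by rewrite !subrr mulr0.
      by case: odd; rewrite ?subrr ?mulr0// subr0 mulr1.
    rewrite -scalemxAr -scalemxAl mxE => h; apply: (mulIf Db).
    rewrite h /q mulrAC divfK// mulrC; congr (_ * _).
    rewrite mxE /num exchange_big /=; apply: eq_bigr => l _.
    by rewrite !mxE big_distrl /=; apply: eq_bigr => k _; rewrite !mxE.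
  apply: continuousM.
    by have := @continuous2_section _ a v (cnum (fun _ _ => u a v) cst_u) a0.
  by apply: continuousV => //; exact: lt0r_neq0.
exists (fun a v => num (u a v) (u a v) / dot (u a v) (u a v)) => //.
have C1l : C1 (eigval i).
  split=> //; exists (fun a v => num (u a v) (u a v) / dot (u a v) (u a v)) => //.
  apply: continuous2M; first exact: cnum.
  by apply: continuous2V; [move=> a v _; exact: lt0r_neq0|exact: cdot].
have C1u j : C1 (fun a v => u a v j).
  apply: (@phi_closed C1 (fun _ v => v)).
  - exact: C1_cst.
  - exact: C1D.
  - exact: C1M.
  - exact: C1V.
  - split; first exact: continuous2_fst.
    by exists (fun _ _ => 1) => [|a v _]; [exact: continuous2_cst|exact: is_derive_id].
  - move=> k; split; first exact: continuous2_entry.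
    by exists (fun _ _ => 0) => [|a v _]; [exact: continuous2_cst|exact: is_derive_cst].
  - exact: C1l.
apply: C1M.
  by do 2![apply: C1_sum => ?]; apply: C1M => //; apply: C1M => //; exact: C1_cst.
apply: C1V; first by move=> a v _; exact: lt0r_neq0.
by apply: C1_sum => k; exact: C1M.
Qed.

Lemma is_derive_unique (f h : R -> R) a (d e : R) : 0 < a ->
  (forall b, 0 < b -> f b = h b) -> is_derive a 1 f d -> is_derive a 1 h e -> d = e.
Proof.
move=> a0 fh df dh.
have fh' : \forall b \near a, f b = h b.
  by have := lt_nbhsr a0; apply: filterS => b; exact: fh.
have dh' := near_eq_is_derive fh' df.
by rewrite -(@derive_val _ _ _ _ _ _ _ dh') (@derive_val _ _ _ _ _ _ _ dh).
Qed.

Variable k : int.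
Hypothesis k0 : k != 0.
Hypothesis kN : (`|k| <= N)%N.

Let idx_lt : (absz (k + N%:Z)%R < p)%N. Proof. by lia. Qed.
Let idx : 'I_p := Ordinal idx_lt.

(** At [v = 0] differentiating [lambda ^+ 2 = disp] twice gives
    [lambda ^+ 3 * lambda'' = s_ k ^+ 2].  The sign of the second derivative
    persists for small [v] because this derivative is continuous in both
    arguments and [a] ranges over a compact interval. *)
Lemma second_derivative_sign (delta : R) : 0 < delta ->
  \forall v \near (0 : 'rV[R]_p), forall a, delta <= a <= 2 ->
    0 < (Num.sg k)%:~R * derive1n 2 (fun b => lambda k b v) a.
Proof.
move=> delta0.
have [_ [g [_ [h ch dg]] dl]] := C1_eigval_derivative idx.
have d2 a v : 0 < a -> derive1n 2 (fun b => lambda k b v) a = h a v.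
  move=> a0; rewrite derive1nS derive1n1 derive1E.
  have gE : \forall b \near a, (fun b => g b v) b = derive1 (fun b => lambda k b v) b.
    have := lt_nbhsr a0; apply: filterS => b b0; rewrite derive1E.
    by rewrite (@derive_val _ _ _ _ _ _ _ (dl b v b0)).
  exact: (@derive_val _ _ _ _ _ _ _ (near_eq_is_derive gE (dg a v a0))).
have lE b : 0 < b -> eigval (N := N) idx b 0 = lambda0 N k b.
  by move=> b0; rewrite -lambda_unperturbed.
(* Half the derivative of [lambda ^ 2 = disp]. *)
have lg a : 0 < a -> lambda0 N k a * g a 0 = a - c_ k.
  move=> a0; apply: (@mulrI _ (2 : R)); first by rewrite unitfE.
  pose f1 := (fun b : R => eigval (N := N) idx b 0) * (fun b => eigval (N := N) idx b 0).
  pose f2 := (cst 1 + id * id : R -> R) - cst (2 * c_ k) * id.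
  have := @is_derive_unique f1 f2 a _ _ a0 _
    (is_deriveM (dl a 0 a0) (dl a 0 a0))
    (is_deriveB (is_deriveD (is_derive_cst (1 : R^o) (a : R^o) (1 : R^o)) (is_deriveM (is_derive_id (a : R^o) (1 : R^o)) (is_derive_id (a : R^o) (1 : R^o))))
                (is_deriveM (is_derive_cst (2 * c_ k : R^o) (a : R^o) (1 : R^o)) (is_derive_id (a : R^o) (1 : R^o)))).
  rewrite /GRing.scale /= lE// => e; rewrite [LHS](_ : _ = lambda0 N k a * g a 0 + lambda0 N k a * g a 0); last by ring.
  rewrite e; last by move=> b b0; rewrite /f1 /f2 /= !fctE lE// -expr2 lambda0_sqr// /disp; ring.
  by ring.
have sg_h a : 0 < a -> 0 < (Num.sg k)%:~R * h a 0.
  move=> a0.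
  have l0 := lambda0_neq0 a k0 kN; have l2 := lambda0_sqr a k0 kN.
  pose f1 := (fun b : R => eigval (N := N) idx b 0) * (fun b => g b 0).
  pose f2 := (id : R -> R) - cst (c_ k).
  have := @is_derive_unique f1 f2 a _ _ a0 _
    (is_deriveM (dl a 0 a0) (dg a 0 a0)) (is_deriveB (is_derive_id (a : R^o) (1 : R^o)) (is_derive_cst (c_ k : R^o) (a : R^o) (1 : R^o))).
  rewrite /GRing.scale /= lE// subr0 => e.
  have {}e : lambda0 N k a * h a 0 + g a 0 * g a 0 = 1.
    by apply: e => b b0; rewrite /f1 /f2 /= !fctE lE// lg.
  have cube : lambda0 N k a ^+ 3 * h a 0 = s_ k ^+ 2.
    have -> : lambda0 N k a ^+ 3 * h a 0 =
        lambda0 N k a ^+ 2 * (lambda0 N k a * h a 0 + g a 0 * g a 0)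
        - (lambda0 N k a * g a 0) ^+ 2 by ring.
    by rewrite e lg// l2 dispE mulr1 addrK.
  have sl : 0 < (Num.sg k)%:~R * lambda0 N k a.
    by rewrite /lambda0 mulrA sgz_sqr// mul1r sqrtr_gt0 disp_gt0.
  have : 0 < (Num.sg k)%:~R * lambda0 N k a * ((Num.sg k)%:~R * h a 0).
    rewrite mulrACA sgz_sqr// mul1r -(pmulr_rgt0 _ (_ : 0 < lambda0 N k a ^+ 2)); last first.
      by rewrite l2 disp_gt0.
    by rewrite mulrA -exprSr cube lt_neqAle sqr_ge0 eq_sym sqrf_eq0 s_neq0.
  by rewrite pmulr_rgt0.
have /compact_near_coveringP cpt := @segment_compact R delta 2.
have := cpt _ (nbhs (0 : 'rV[R]_p)) (fun v a => 0 < (Num.sg k)%:~R * h a v) _ _.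
have P x : `[delta, 2]%classic x ->
    \forall x' \near x & v \near (0 : 'rV[R]_p), 0 < (Num.sg k)%:~R * h x' v.
  rewrite /= in_itv /= => /andP[dx _]; have x0 := lt_le_trans delta0 dx.
  have c2 := continuous2M (@continuous2_cst (Num.sg k)%:~R) ch.
  exact: (c2 x 0 x0 _ (lt_nbhsr (sg_h x x0))).
move=> /(_ (nbhs_filter _) P); apply: filterS => v hv a da.
have a0 : 0 < a by case/andP: da => da _; exact: lt_le_trans da.
by rewrite d2//; apply: hv; rewrite /= in_itv.
Qed.

End SecondDerivative.

End Perturbation.

(** * Normalization of the unperturbed eigenvectors *)

Section Bands.
Variables (R : realType) (N : nat).
Local Notation p := ((2 * N).+1).
Local Notation c_ := (c_ R N).
Local Notation s_ := (s_ R N).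
Implicit Types (a b x y : R) (v w : 'rV[R]_p).

Lemma sum_even_odd n (F : nat -> R) :
  \sum_(i < (2 * n).+1) F i + F (2 * n).+1 = \sum_(i < n.+1) (F i.*2 + F i.*2.+1).
Proof.
elim: n => [|n IH]; first by rewrite !big_ord1.
rewrite [RHS]big_ord_recr /= -IH -mul2n mulnS add2n big_ord_recr /= big_ord_recr /=.
by rewrite -!addrA.
Qed.

Lemma le_eucl_norm n (v : 'rV[R]_n) : `|v| <= eucl_norm v.
Proof.
rewrite [leLHS]/Num.norm /= mx_normrE; apply/bigmax_leP; split=> [|-[i j] _].
  exact: sqrtr_ge0.
rewrite (ord1 i) -sqrtr_sqr ler_sqrt; last by apply: sumr_ge0 => l _; rewrite sqr_ge0.
by rewrite (bigD1 j)//= lerDl sumr_ge0// => l _; rewrite sqr_ge0.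
Qed.

Lemma coord1E v (i : 'I_p) : coord1 v i.+1 = v 0 i.
Proof. by rewrite /coord1 (valK i). Qed.

Lemma coord1_out v j : (p <= j)%N -> coord1 v j.+1 = 0.
Proof. by move=> pj; rewrite /coord1 insubF// ltnNge pj. Qed.

Variable k : int.
Hypothesis k0 : k != 0.
Hypothesis kN : (`|k| <= N)%N.
Local Notation sg := ((Num.sg k)%:~R : R).
Local Notation sn n := (s_ (n%:Z * k)).

Let sgM : sg * sg = 1. Proof. exact: sgz_sqr. Qed.
Let normr_sg_int : `|sg| = 1.
Proof. by apply/eqP; rewrite -sqr_norm_eq1 expr2 sgM. Qed.

Lemma sum_sines_shift : \sum_(n < N.+1) sn n ^+ 2 = \sum_(n < N.+1) sn n.+1 ^+ 2.
Proof.
rewrite big_ord_recl [RHS]big_ord_recr /= mul0r s_0 s_full !expr0n /= add0r addr0.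
by apply: eq_bigr => i _.
Qed.

(** Summation of the recurrence [s_next] against the sine wave itself. *)
Lemma sum_sine_products :
  \sum_(n < N.+1) sn n * sn n.+1 = c_ k * \sum_(n < N.+1) sn n.+1 ^+ 2.
Proof.
have reindex : \sum_(n < N.+1) sn n.+1 * sn n.+2 = \sum_(n < N.+1) sn n * sn n.+1.
  rewrite big_ord_recr [RHS]big_ord_recl /= mul0r s_0 s_full !mul0r add0r addr0.
  by apply: eq_bigr => i _.
apply: (@mulrI _ (2 : R)); first by rewrite unitfE.
rewrite mulrA [RHS]mulr_sumr [RHS](eq_bigr (fun n : 'I_N.+1 => sn n.+1 * sn n.+2 + sn n * sn n.+1)).
  by rewrite big_split /= reindex mulrDl mul1r.
by move=> n _; rewrite s_next; ring.
Qed.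

(** The even and the odd half of an unperturbed eigenvector carry the same
    weight. *)
Lemma sum_psi0_even a :
  \sum_(n < N.+1) psi0 N k a n.*2 ^+ 2 = \sum_(n < N.+1) sn n.+1 ^+ 2.
Proof.
have d0 := disp_gt0 a k0 kN.
apply: (@mulfI _ (disp N k a)); first by rewrite gt_eqF.
transitivity (\sum_(n < N.+1) (a ^+ 2 * sn n.+1 ^+ 2 + (-2 * a) * (sn n * sn n.+1) + sn n ^+ 2)).
  rewrite mulr_sumr; apply: eq_bigr => n _.
  rewrite psi0_even exprMn -signr_odd sqrr_sign mul1r exprMn exprVn lambda0_sqr//.
  by field; rewrite gt_eqF.
rewrite !big_split /= sum_sines_shift -!mulr_sumr sum_sine_products.
by rewrite /disp; ring.
Qed.

Lemma psi0_even_sqr_c (n : nat) : psi0 N k (c_ k) n.*2 ^+ 2 = c_ (n.+1%:Z * k) ^+ 2.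
Proof.
rewrite psi0_even exprMn -signr_odd sqrr_sign mul1r exprMn exprVn lambda0_sqr//.
rewrite dispE subrr expr0n /= addr0 (_ : n%:Z * k = n.+1%:Z * k - k); last first.
  by rewrite -[in RHS]addn1 PoszD mulrDl mul1r addrK.
rewrite s_D c_N s_N; have := s_neq0 R k0 kN.
by move: (s_ k) => s s0; field.
Qed.

Lemma psi0_odd_sqr a (n : nat) : psi0 N k a n.*2.+1 ^+ 2 = sn n.+1 ^+ 2.
Proof. by rewrite psi0_odd exprMn -signr_odd sqrr_sign mul1r. Qed.

(** The weights do not depend on [a], and at [a = c_ k] the squares of the two
    halves are squares of cosines and of sines of the same angles. *)
Lemma sum_psi0 a : \sum_(i < p) psi0 N k a i ^+ 2 = N.+1%:R.
Proof.
have tot b : \sum_(i < p) psi0 N k b i ^+ 2 =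
    \sum_(n < N.+1) psi0 N k b n.*2 ^+ 2 + \sum_(n < N.+1) sn n.+1 ^+ 2.
  have := sum_even_odd N (fun i => psi0 N k b i ^+ 2).
  rewrite psi0_end expr0n addr0 => ->; rewrite big_split /=; congr (_ + _).
  by apply: eq_bigr => n _; rewrite psi0_odd_sqr.
rewrite tot sum_psi0_even -{1}(sum_psi0_even (c_ k)) -big_split /=.
rewrite (eq_bigr (fun=> 1)) ?sumr_const ?card_ord// => n _.
by rewrite psi0_even_sqr_c c_s_sq.
Qed.

Lemma first_order_shiftE (a0 : R) v :
  first_order_shift a0 k v = N.+1%:R^-1 * \sum_(i < p) v 0 i * psi0 N k a0 i ^+ 2.
Proof. by rewrite /first_order_shift sum_psi0 mulrC. Qed.

Lemma first_order_shift_c v : first_order_shift (c_ k) k v = N.+1%:R^-1 *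
  \sum_(1 <= n < N.+2)
    (c_ (n%:Z * k) ^+ 2 * coord1 v (2 * n - 1) + s_ (n%:Z * k) ^+ 2 * coord1 v (2 * n)).
Proof.
rewrite first_order_shiftE; congr (_ * _).
rewrite (eq_bigr (fun i : 'I_p => coord1 v i.+1 * psi0 N k (c_ k) i ^+ 2)); last first.
  by move=> i _; rewrite coord1E.
have := sum_even_odd N (fun i => coord1 v i.+1 * psi0 N k (c_ k) i ^+ 2).
rewrite coord1_out// mul0r addr0 => ->; rewrite big_add1 [N.+2.-1]/= big_mkord.
apply: eq_bigr => n _; rewrite psi0_even_sqr_c psi0_odd_sqr.
have -> : (2 * n.+1 - 1 = n.*2.+1)%N by lia.
have -> : (2 * n.+1 = n.*2.+2)%N by lia.
by ring.
Qed.

Lemma chi_psi0 (i : nat) : chi R N k i.+1 = psi0 N k 2 i ^+ 2.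
Proof.
rewrite /chi -(odd_double_half i); case: (odd i) (i./2) => n; rewrite ?add1n ?add0n.
  rewrite psi0_odd_sqr [odd _]/= odd_double /= -/n.+1; congr (s_ _ ^+ 2).
  by rewrite mulrC doubleK.
rewrite [odd _]/= odd_double /= uphalf_double psi0_even exprMn -signr_odd sqrr_sign mul1r.
rewrite exprMn exprVn lambda0_sqr// (_ : disp N k 2 = 5 - 4 * c_ k); last by rewrite /disp; ring.
by congr (_ / _); ring.
Qed.

Lemma first_order_shift_2 v : first_order_shift 2 k v = \sum_(1 <= n < (2 * N).+2) chi R N k n * coord1 v n / N.+1%:R.
Proof.
rewrite first_order_shiftE mulr_sumr big_add1 [(2 * N).+2.-1]/= big_mkord; apply: eq_bigr => i _.
by rewrite chi_psi0 coord1E; ring.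
Qed.

Lemma norm_first_order_shift (a0 : R) v : `|first_order_shift a0 k v| <= `|v|.
Proof.
rewrite first_order_shiftE normrM ger0_norm ?invr_ge0// ler_pdivrMl ?ltr0n// -(sum_psi0 a0) mulr_suml.
apply: le_trans (ler_norm_sum _ _ _) (ler_sum _ _) => i _.
rewrite normrM mulrC [X in X * _]ger0_norm ?sqr_ge0// ler_wpM2l ?sqr_ge0//.
exact: row_coord_le.
Qed.

(** * Band edges *)

Lemma inf_close (A : set R) (m e : R) : (exists2 x, A x & x <= m + e) ->
  (forall x, A x -> m - e <= x) -> `|inf A - m| <= e.
Proof.
move=> [x Ax xm] lb; have hlb : has_lbound A by exists (m - e).
rewrite ler_distl; apply/andP; split; last exact: le_trans (ge_inf hlb Ax) xm.
by apply: lb_le_inf; [exists x|].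
Qed.

Lemma sup_close (A : set R) (m e : R) : (exists2 x, A x & m - e <= x) ->
  (forall x, A x -> x <= m + e) -> `|sup A - m| <= e.
Proof.
move=> [x Ax xm] ub; have hub : has_ubound A by exists (m + e).
rewrite ler_distl; apply/andP; split; first exact: le_trans xm (ub_le_sup hub Ax).
by apply: ge_sup; [exists x|].
Qed.

Let idx_lt : (absz (k + N%:Z)%R < p)%N. Proof. by lia. Qed.
Let idx : 'I_p := Ordinal idx_lt.

Let near_norm_le (d : R) : 0 < d -> \forall v \near (0 : 'rV[R]_p), `|v| <= d.
Proof. by move=> d0; exact: (@nbhs0_le _ 'rV[R]_p d d0). Qed.

Let p1_gt0 : 0 < p%:R + 1 :> R. Proof. by rewrite ltr_wpDl. Qed.

Let disp_ge0 a : 0 <= disp N k a. Proof. exact/ltW/disp_gt0. Qed.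

(** A norm of [(s_ k, a - c_ k)], hence 1-Lipschitz in [a]. *)
Lemma sqrt_disp_lip a b : `|Num.sqrt (disp N k a) - Num.sqrt (disp N k b)| <= `|a - b|.
Proof.
set x := Num.sqrt (disp N k a); set y := Num.sqrt (disp N k b).
have xpos : 0 < x by rewrite sqrtr_gt0 disp_gt0.
have ypos : 0 < y by rewrite sqrtr_gt0 disp_gt0.
have le_sqrt c : `|c - c_ k| <= Num.sqrt (disp N k c).
  by rewrite -sqrtr_sqr ler_sqrt ?disp_ge0// dispE lerDr sqr_ge0.
have xy : (x - y) * (x + y) = (a - b) * ((a - c_ k) + (b - c_ k)).
  transitivity (x ^+ 2 - y ^+ 2); first by ring.
  by rewrite !sqr_sqrtr ?disp_ge0// !dispE; ring.
rewrite -(@ler_pM2r _ (x + y)) ?addr_gt0//.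
rewrite -[X in _ * X <= _]gtr0_norm ?addr_gt0// -normrM xy normrM ler_wpM2l//.
by apply: le_trans (ler_normD _ _) _; apply: lerD.
Qed.

(** By continuity at [a = 0], where the numbers [lambda0 k a] need not be distinct. *)
Lemma lambda_unperturbed_ge0 a : 0 <= a -> lambda (N := N) k a 0 = lambda0 N k a.
Proof.
rewrite le_eqVlt => /predU1P[<-|]; last by move=> ?; exact: lambda_unperturbed.
apply/eqP; rewrite -subr_eq0 -normr_le0; apply/ler_addgt0Pl => e e0; rewrite addr0.
pose b := e / (p%:R + 1); have b0 : 0 < b by rewrite divr_gt0// ltr_wpDl.
have h1 : `|lambda (N := N) k 0 0 - lambda (N := N) k b 0| <= _ := @eigval_lip R N idx 0 b 0 0.
have hb : `|0 - b| + `|0 - 0 : 'rV[R]_p| = b.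
  by rewrite sub0r normrN gtr0_norm// subrr normr0 addr0.
rewrite hb in h1.
have h2 := sqrt_disp_lip b 0; rewrite subr0 (gtr0_norm b0) in h2.
have h3 : `|lambda0 N k b - lambda0 N k 0| <= b.
  by rewrite /lambda0 -mulrBr normrM normr_sg_int mul1r.
have h4 : lambda (N := N) k b 0 = lambda0 N k b by exact: lambda_unperturbed.
have -> : lambda (N := N) k 0 0 - lambda0 N k 0 =
    (lambda (N := N) k 0 0 - lambda (N := N) k b 0) + (lambda0 N k b - lambda0 N k 0).
  by rewrite -h4 addrA subrK.
apply: le_trans (ler_normD _ _) _; apply: le_trans (lerD h1 h3) _.
by rewrite -[X in _ + X]mul1r -mulrDl /b mulrCA divff ?mulr1// gt_eqF// ltr_wpDl.
Qed.

Lemma band_close (a : R) v : 0 <= a ->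
  `|sg * lambda k a v - Num.sqrt (disp N k a)| <= p%:R * `|v|.
Proof.
move=> a0; have := @eigval_lip R N idx a a v 0.
rewrite [a - a]subrr normr0 add0r [v - 0]subr0; apply: le_trans.
rewrite -[Num.sqrt _]mul1r -[X in X * Num.sqrt _]sgM -mulrA -/(lambda0 N k a).
by rewrite -lambda_unperturbed_ge0// -mulrBr normrM normr_sg_int mul1r.
Qed.

(** Multiplication by the sign of [k] treats both halves of the spectrum at once:
    it turns the inner band edge into a minimum. *)
Lemma lambda_minus_close v m e :
  (exists2 a, 0 <= a <= 2 & sg * lambda k a v <= m + e) ->
  (forall a, 0 <= a <= 2 -> m - e <= sg * lambda k a v) ->
  `|lambda_minus k v - sg * m| <= e.
Proof.
move=> [a a02 am] lb; rewrite /lambda_minus; case: ifPn => [kge|klt].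
  have sg1 : sg = 1 by rewrite gtr0_sg// lt_neqAle eq_sym k0.
  rewrite sg1 mul1r; apply: inf_close.
    by exists (lambda k a v); [exists a|rewrite -[leLHS]mul1r -sg1].
  by move=> _ [b b02 <-]; rewrite -[leRHS]mul1r -sg1; exact: lb.
have sg1 : sg = -1 by rewrite ltr0_sg// ltNge.
rewrite sg1 mulN1r; apply: sup_close.
  by exists (lambda k a v); [exists a|move: am; rewrite sg1; move: (lambda k a v) => x; lra].
by move=> _ [b b02 <-]; move: (lb b b02); rewrite sg1; move: (lambda k b v) => x; lra.
Qed.

Lemma lambda_plus_close v m e :
  (exists2 a, 0 <= a <= 2 & m - e <= sg * lambda k a v) ->
  (forall a, 0 <= a <= 2 -> sg * lambda k a v <= m + e) ->
  `|lambda_plus k v - sg * m| <= e.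
Proof.
move=> [a a02 am] lb; rewrite /lambda_plus; case: ifPn => [kge|klt].
  have sg1 : sg = 1 by rewrite gtr0_sg// lt_neqAle eq_sym k0.
  rewrite sg1 mul1r; apply: sup_close.
    by exists (lambda k a v); [exists a|rewrite -[leRHS]mul1r -sg1].
  by move=> _ [b b02 <-]; rewrite -[leLHS]mul1r -sg1; exact: lb.
have sg1 : sg = -1 by rewrite ltr0_sg// ltNge.
rewrite sg1 mulN1r; apply: inf_close.
  by exists (lambda k a v); [exists a|move: am; rewrite sg1; move: (lambda k a v) => x; lra].
by move=> _ [b b02 <-]; move: (lb b b02); rewrite sg1; move: (lambda k b v) => x; lra.
Qed.

Lemma first_order_sg (a0 : R) : 0 < a0 -> exists2 C, 0 <= C & \forall e \near 0^'+,
  forall a v, base_dist a0 a v <= e ->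
  `|sg * lambda k a v - Num.sqrt (disp N k a) - sg * first_order_shift a0 k v| <= C * (`|v| * base_dist a0 a v).
Proof.
move=> a00; have [C C0 h] := @first_order R N a0 a00 k k0 kN; exists C => //.
apply: filterS h => e h a v he; apply: le_trans (h a v he).
rewrite -[Num.sqrt _]mul1r -[X in X * Num.sqrt _]sgM -mulrA -/(lambda0 N k a).
by rewrite -!mulrBr normrM normr_sg_int mul1r.
Qed.

Lemma c_lt1 : c_ k < 1.
Proof.
have := c_s_sq R N k; have := s_neq0 R k0 kN; rewrite -sqrf_eq0 => s0 cs.
have s1 : 0 < s_ k ^+ 2 by rewrite lt_neqAle eq_sym s0 sqr_ge0.
by nra.
Qed.

Lemma s_abs : s_ `|k| = `|s_ k|.
Proof.
have spos (n : nat) : (0 < n <= N)%N -> `|s_ n| = s_ n.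
  by move=> nN; rewrite gtr0_norm// s_gt0.
case: k k0 kN => [[|n]|n] //= _ nN; first by rewrite spos.
by rewrite NegzE normrN s_N normrN spos.
Qed.

(** If [c_ k] lies inside [(0, 2)] the unperturbed eigenvalue has a nondegenerate
    critical point there, and the error made by replacing the critical point of
    the perturbed eigenvalue by it is of second order. *)
Lemma lambda_minus_interior : 0 < c_ k -> exists2 D, 0 < D &
  \forall v \near (0 : 'rV[R]_p),
    `|lambda_minus k v - sg * (s_ `|k| + sg * first_order_shift (c_ k) k v)| <= D * `|v| ^+ 2.
Proof.
move=> c0; have [C C0 h] := first_order_sg c0.
have c1 := c_lt1.
have [e [e0 he]] : exists e, 0 < e /\ forall a v, base_dist (c_ k) a v <= e ->
    `|sg * lambda k a v - Num.sqrt (disp N k a) - sg * first_order_shift (c_ k) k v|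
      <= C * (`|v| * base_dist (c_ k) a v).
  have pos : \forall e \near (0 : R)^'+, 0 < e by exact: nbhs_right_gt.
  by have [e] := filter_ex (filterI pos h); exists e.
exists (C + C ^+ 2 + 1); first by rewrite ltr_wpDl// addr_ge0// sqr_ge0.
set S := s_ `|k|.
have S0 : 0 < S by rewrite /S s_abs normr_gt0 s_neq0.
have S2 : S ^+ 2 = s_ k ^+ 2 by rewrite /S s_abs real_normK// num_real.
have S1 : S <= 1.
  have := c_s_sq R N k; rewrite -S2 => cs; have := sqr_ge0 (c_ k) => cc.
  by nra.
(* Quadratic growth at [c_ k]: with [t = a - c_ k] the square of the left side
   is [S^2 + S t^2 / 2 + t^4 / 16 <= S^2 + t^2], as [S <= 1] and [t^2 <= 4]. *)
have rS a : 0 <= a <= 2 -> S + (a - c_ k) ^+ 2 / 4 <= Num.sqrt (disp N k a).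
  move=> /andP[a0 a2]; set t := a - c_ k.
  have t2 : t ^+ 2 <= 4 by rewrite /t; nra.
  have tt := sqr_ge0 t.
  have L0 : 0 <= S + t ^+ 2 / 4 by lra.
  rewrite -[leLHS]ger0_norm// -sqrtr_sqr ler_sqrt; last exact: disp_ge0.
  by rewrite dispE -S2 -/t; nra.
have e2_gt0 : 0 < e / 2 by rewrite divr_gt0.
have e16_gt0 : 0 < e ^+ 2 / 16 / (p%:R + 1) by rewrite !divr_gt0 ?exprn_gt0.
apply: filterS2 (near_norm_le e2_gt0) (near_norm_le e16_gt0) => v v1 v2.
have v0 := normr_ge0 v.
have sL : `|sg * first_order_shift (c_ k) k v| <= `|v|.
  by rewrite normrM normr_sg_int mul1r norm_first_order_shift.
move: sL; rewrite ler_norml => /andP[sL1 sL2].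
apply: lambda_minus_close.
  exists (c_ k); first by rewrite ltW//=; lra.
  have dv : base_dist (c_ k) (c_ k) v = `|v| by rewrite /base_dist subrr normr0 add0r.
  have := he (c_ k) v; rewrite dv => /(_ _); move=> /(_ (le_trans v1 _)).
  rewrite dispE subrr expr0n addr0 sqrtr_sqr -s_abs -/S.
  have e2 : e / 2 <= e by lra.
  move=> /(_ e2); rewrite ler_norml => /andP[_ h2].
  have CC := sqr_ge0 C; nra.
move=> a a02; have r := rS a a02.
have [near_c|far] := leP `|a - c_ k| (e / 2).
  have : base_dist (c_ k) a v <= e by rewrite /base_dist; lra.
  move=> /(he a v); rewrite ler_norml => /andP[h1 _].
  rewrite /base_dist in h1; set t := `|a - c_ k| in h1 near_c.
  have tE : (a - c_ k) ^+ 2 = t ^+ 2 by rewrite /t real_normK// num_real.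
  rewrite tE in r.
  (* completing the square absorbs the mixed term *)
  have sq := sqr_ge0 (t / 2 - C * `|v|).
  have vv := sqr_ge0 `|v|.
  nra.
have a0 : 0 <= a by case/andP: a02.
have := band_close v a0; rewrite ler_norml => /andP[h1 _].
have ac2 : e ^+ 2 / 4 <= (a - c_ k) ^+ 2.
  rewrite -[(a - c_ k) ^+ 2]real_normK ?num_real//.
  have e2 : 0 < e / 2 by rewrite divr_gt0.
  by nra.
have vp : p%:R * `|v| + `|v| <= e ^+ 2 / 16.
  by move: v2; rewrite ler_pdivlMr ?ltr_wpDl// mulrDr mulr1 mulrC.
have D0 : 0 <= (C + C ^+ 2 + 1) * `|v| ^+ 2 by rewrite mulr_ge0 ?sqr_ge0// !addr_ge0// sqr_ge0.
lra.
Qed.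

(** The unperturbed minimum is the value [1] at [a = 0], where the spectrum
    may be degenerate; Weyl's inequality is all that is used. *)
Lemma lambda_minus_boundary v : c_ k <= 0 -> `|lambda_minus k v - sg * 1| <= p%:R * `|v|.
Proof.
move=> c0.
have r1 a : 0 <= a -> 1 <= Num.sqrt (disp N k a).
  move=> a0; rewrite -[leLHS]sqrtr1 ler_sqrt ?disp_ge0// /disp.
  by have := sqr_ge0 a; nra.
apply: lambda_minus_close.
  exists 0; first by rewrite lexx ler0n.
  have := band_close v (lexx (0 : R)); rewrite /disp expr0n mulr0 mul0r subr0 addr0 sqrtr1.
  by rewrite ler_norml => /andP[_ h]; lra.
move=> a /andP[a0 _]; have := band_close v a0; rewrite ler_norml => /andP[h _].
by have := r1 a a0; lra.
Qed.

(** The unperturbed eigenvalue attains its maximum at the endpoint [2] with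
    nonzero slope, so for small [v] the perturbed one does too, up to second
    order terms. *)
Lemma lambda_plus_expansion : exists2 D, 0 < D &
  \forall v \near (0 : 'rV[R]_p),
    `|lambda_plus k v - sg * (Num.sqrt (5 - 4 * c_ k) + sg * first_order_shift 2 k v)| <= D * `|v| ^+ 2.
Proof.
have two0 : 0 < 2 :> R by rewrite ltr0n.
have [C C0 h] := first_order_sg two0.
have c1 := c_lt1.
have [e [e0 he]] : exists e, 0 < e /\ forall a v, base_dist 2 a v <= e ->
    `|sg * lambda k a v - Num.sqrt (disp N k a) - sg * first_order_shift 2 k v| <= C * (`|v| * base_dist 2 a v).
  have pos : \forall e \near (0 : R)^'+, 0 < e by exact: nbhs_right_gt.
  by have [e] := filter_ex (filterI pos h); exists e.
exists (C + 1); first by rewrite ltr_wpDl.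
have d2 : disp N k 2 = 5 - 4 * c_ k by rewrite /disp; ring.
rewrite -d2; set M := Num.sqrt (disp N k 2).
pose kap := (1 - c_ k) / 3.
have kap0 : 0 < kap by rewrite divr_gt0// subr_gt0.
have cm1 : -1 <= c_ k by have := c_s_sq R N k; have := sqr_ge0 (s_ k); nra.
have le3 a : 0 <= a <= 2 -> Num.sqrt (disp N k a) <= 3.
  move=> /andP[a0 a2]; rewrite -[leRHS]ger0_norm// -sqrtr_sqr ler_sqrt ?sqr_ge0// /disp.
  by nra.
(* [M^2 - disp a = (2 - a) (2 + a - 2 c_k)], and [M + sqrt (disp a) <= 6]. *)
have slope a : 0 <= a <= 2 -> Num.sqrt (disp N k a) <= M - kap * (2 - a).
  move=> a02; have r3 := le3 a a02; have M3 : M <= 3 by apply: le3; rewrite lexx ltW.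
  case/andP: a02 => a0 a2.
  have ra : Num.sqrt (disp N k a) ^+ 2 = disp N k a by rewrite sqr_sqrtr ?disp_ge0.
  have rM : M ^+ 2 = disp N k 2 by rewrite sqr_sqrtr ?disp_ge0.
  have M0 : 0 < M by rewrite sqrtr_gt0 disp_gt0.
  have r0 : 0 < Num.sqrt (disp N k a) by rewrite sqrtr_gt0 disp_gt0.
  set r := Num.sqrt _ in r3 ra r0 *.
  have diff : (M - r) * (M + r) = (2 - a) * (2 + a - 2 * c_ k).
    transitivity (M ^+ 2 - r ^+ 2); first by ring.
    by rewrite ra rM /disp; ring.
  rewrite lerBrDr -lerBrDl -(@ler_pM2r _ (M + r)) ?addr_gt0// diff.
  rewrite mulrAC mulrC ler_wpM2l ?subr_ge0//.
  have -> : kap * (M + r) = (1 - c_ k) * ((M + r) / 3) by rewrite /kap; field.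
  have : (M + r) / 3 <= 2 by lra.
  move: (_ / 3) => q q2.
  have hq : (1 - c_ k) * q <= (1 - c_ k) * 2 by rewrite ler_wpM2l// subr_ge0 ltW.
  lra.
have e2_gt0 : 0 < e / 2 by rewrite divr_gt0.
have b2 : 0 < kap * (e / 2) / (p%:R + 1) by rewrite divr_gt0// mulr_gt0.
have b3 : 0 < kap / (C + 1) by rewrite divr_gt0// ltr_wpDl.
apply: filterS3 (near_norm_le e2_gt0) (near_norm_le b2) (near_norm_le b3) => v v1 v2 v3.
have v0 := normr_ge0 v; have vv := sqr_ge0 `|v|.
have sL : `|sg * first_order_shift 2 k v| <= `|v| by rewrite normrM normr_sg_int mul1r norm_first_order_shift.
move: sL; rewrite ler_norml => /andP[sL1 sL2].
apply: lambda_plus_close.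
  exists 2; first by rewrite lexx ltW.
  have dv : base_dist 2 2 v = `|v| by rewrite /base_dist subrr normr0 add0r.
  have e2 : e / 2 <= e by lra.
  have := he 2 v; rewrite dv => /(_ (le_trans v1 e2)).
  rewrite ler_norml -/M => /andP[h1 _].
  nra.
move=> a a02; have r := slope a a02; have /andP[a0 a2] := a02.
have da : `|a - 2| = 2 - a by rewrite distrC ger0_norm// subr_ge0.
have [near_2|far] := leP (2 - a) (e / 2).
  have : base_dist 2 a v <= e by rewrite /base_dist da; lra.
  move=> /(he a v); rewrite ler_norml /base_dist da => /andP[_ h1].
  have Cv : C * `|v| <= kap.
    by move: v3; rewrite ler_pdivlMr ?ltr_wpDl// mulrDr mulr1 mulrC; lra.
  have := ler_wpM2r (_ : 0 <= 2 - a) Cv; rewrite subr_ge0 => /(_ a2) h2.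
  nra.
have := band_close v a0; rewrite ler_norml => /andP[_ h1].
have vp : p%:R * `|v| + `|v| <= kap * (e / 2).
  by move: v2; rewrite ler_pdivlMr ?ltr_wpDl// mulrDr mulr1 mulrC.
have hk : kap * (e / 2) <= kap * (2 - a) by rewrite ler_wpM2l// ltW.
have D0 : 0 <= (C + 1) * `|v| ^+ 2 by rewrite mulr_ge0// addr_ge0.
lra.
Qed.

End Bands.

(** * The theorem *)

Section Assembly.
Variables (R : realType) (N : nat).
Local Notation p := ((2 * N).+1).
Local Notation c_ := (c_ R N).
Local Notation s_ := (s_ R N).

Let angle (k : int) : c_ k = cos ((absz k)%:R * (pi / N.+1%:R)).
Proof.
rewrite /Defs.c_ -mulrA -cos_norm normrM [X in _ * X]ger0_norm; last first.
  by rewrite divr_ge0// pi_ge0.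
by rewrite -intr_norm -abszE.
Qed.

Lemma c_gt0 (k : int) : ((absz k)%:R < N.+1%:R / 2 :> R) -> 0 < c_ k.
Proof.
move=> kN; rewrite angle; apply: cos_gt0_pihalf.
have pi0 := pi_gt0 R; have n0 : 0 < N.+1%:R :> R by rewrite ltr0n.
rewrite (lt_le_trans (_ : _ < 0)) ?mulr_ge0 ?divr_ge0 ?(ltW pi0)//=; last by rewrite oppr_lt0 divr_gt0.
by rewrite mulrA ltr_pdivrMr// mulrC [ltRHS]mulrAC -[ltRHS]mulrA ltr_pM2l.
Qed.

Lemma c_le0 (k : int) : (absz k <= N)%N -> N.+1%:R / 2 <= (absz k)%:R :> R -> c_ k <= 0.
Proof.
move=> kN kN2; rewrite angle -(@cos_pihalf R).
have pi0 := pi_gt0 R; have n0 : 0 < N.+1%:R :> R by rewrite ltr0n.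
have le1 : pi / 2 <= (absz k)%:R * (pi / N.+1%:R) :> R.
  rewrite mulrA ler_pdivlMr// [leLHS](_ : _ = N.+1%:R / 2 * pi) ?ler_pM2r//.
  by rewrite mulrAC [pi * _]mulrC mulrAC.
have le2 : (absz k)%:R * (pi / N.+1%:R) <= pi :> R.
  by rewrite mulrA ler_pdivrMr// mulrC ler_pM2l// ler_nat ltnW.
rewrite leNgt ltr_cos -?leNgt// in_itv /=.
- by rewrite le2 andbT mulr_ge0// divr_ge0// ltW.
- by apply/andP; split; lra.
Qed.

Let idx_lt (k : int) : (absz k <= N)%N -> (absz (k + N%:Z)%R < p)%N.
Proof. by lia. Qed.

Lemma lambda_joint_analytic (k : int) (a : R) (v : 'rV[R]_p) : (absz k <= N)%N -> a != 0 ->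
  real_analytic_at (lambda_joint (N := N) k) (row_mx a%:M v).
Proof.
move=> kN a0; apply: (@eigval_analytic R N (Ordinal (idx_lt kN))) => j.
rewrite row_mxKl row_mxKr mxE mulr1n; apply: contra_neq.
exact: eigval_inj.
Qed.

(** Comparison with the unperturbed matrix at a small positive [a], where all
    eigenvalues but the middle one are close to [1] or [-1]. *)
Lemma lambda_joint0_analytic : \forall x \near (0 : 'rV[R]_(1 + p)),
  real_analytic_at (lambda_joint (N := N) 0) x.
Proof.
have [q q0 qE] : exists2 q : R, 0 < q & q = p%:R by exists p%:R; rewrite ?ltr0n.
pose b : R := (16 * q)^-1; have qb : q * b = 16^-1 by rewrite /b; field; rewrite gt_eqF.
have b0 : 0 < b by rewrite invr_gt0 mulr_gt0.
have q1 : 1 <= q by rewrite qE ler1n.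
have b1 : b <= 16^-1 by nra.
have := @nbhs0_le _ 'rV[R]_(1 + p) b b0; apply: filterS => x xb.
have kN0 : (absz 0 <= N)%N by [].
apply: (@eigval_analytic R N (Ordinal (idx_lt kN0))) => j j0.
set a := lsubmx x 0 0; set v := rsubmx x.
have ab : `|a| <= b by rewrite /a mxE; apply: le_trans (row_coord_le _ _) xb.
have vb : `|v| <= b.
  apply: le_trans xb; rewrite [leLHS]/Num.norm /= mx_normrE.
  apply/bigmax_leP; split=> // -[i l] _.
  by rewrite mxE (ord1 i); exact: row_coord_le.
have close (i : 'I_p) : `|eigval i a v - lambda0 N (i%:Z - N%:Z) b| <= 3 / 16.
  have := eigval_lip i a b v 0; rewrite -qE subr0.
  rewrite [eigval i b 0](_ : _ = lambda0 N (i%:Z - N%:Z) b).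
    move/le_trans; apply.
    have := ler_normB a b; rewrite (gtr0_norm b0) => hab.
    have : `|a - b| + `|v| <= 3 * b by lra.
    by move=> /(ler_wpM2l (ltW q0)) h; apply: le_trans h _; rewrite mulrCA qb.
  have iN : (absz (i%:Z - N%:Z)%R <= N)%N by have := ltn_ord i; lia.
  by rewrite -lambda_unperturbed// lambdaE subrK.
have l0 : `|eigval (Ordinal (idx_lt kN0)) a v| <= 3 / 16.
  have := close (Ordinal (idx_lt kN0)).
  rewrite [X in lambda0 N X](_ : _ = 0); last by rewrite /=; lia.
  by rewrite /lambda0 sgr0 mul0r subr0.
have kj0 : (j%:Z - N%:Z)%R != 0.
  by apply: contra_neq j0 => jN; apply: val_inj => /=; lia.
have lj : 15 / 16 <= `|lambda0 N (j%:Z - N%:Z) b|.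
  have jN : (absz (j%:Z - N%:Z)%R <= N)%N by have := ltn_ord j; lia.
  rewrite -[leLHS]ger0_norm// -ler_sqr ?nnegrE// !real_normK ?num_real//.
  rewrite lambda0_sqr// /disp; have := cos_le1 ((j%:Z - N%:Z)%:~R * pi / N.+1%:R : R).
  by rewrite -/(c_ _) => c1; nra.
apply: contraTneq (close j) => ->; rewrite -ltNge.
have := lerB_dist (lambda0 N (j%:Z - N%:Z) b) (eigval (Ordinal (idx_lt kN0)) a v).
rewrite distrC; lra.
Qed.

Let norm_eucl_sqr n (v : 'rV[R]_n) : `|v| ^+ 2 <= `|eucl_norm v ^+ 2|.
Proof.
rewrite ger0_norm ?exprn_ge0 ?sqrtr_ge0// lerXn2r ?nnegrE ?sqrtr_ge0//.
exact: le_eucl_norm.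
Qed.

Lemma bigO_eucl_sqr n (f : 'rV[R]_n -> R) :
  (exists2 D, 0 < D & \forall v \near (0 : 'rV[R]_n), `|f v| <= D * `|v| ^+ 2) ->
  f =O_ (0 : 'rV[R]_n) (fun v => eucl_norm v ^+ 2).
Proof.
move=> [D D0 fD]; apply/eqO_exP; exists D => //; apply: filterS fD => v fv.
by apply: le_trans fv _; rewrite ler_wpM2l// ltW.
Qed.

Lemma sg_expansion (k : int) (x y z : R) : k != 0 ->
  x - (y * (Num.sg k)%:~R + z) = x - (Num.sg k)%:~R * (y + (Num.sg k)%:~R * z).
Proof. by move=> k0; rewrite mulrDr mulrA sgz_sqr// mul1r [_ * y]mulrC. Qed.

End Assembly.

Theorem theorem1p3 (R : realType) (N : nat) (hN : (1 <= N)%N) :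
  [/\ forall (k : int), k != 0 -> (`|k| <= N)%N ->
        forall (a : R) (v : 'rV[R]_((2 * N).+1)), 0 < a <= 2 ->
          real_analytic_at (lambda_joint (N := N) k) (row_mx a%:M v),
      \forall delta \near (0 : R)^'+,
        \forall v \near (0 : 'rV[R]_((2 * N).+1)),
          forall (k : int), k != 0 -> (`|k| <= N)%N ->
          forall a : R, delta <= a <= 2 ->
            0 < (Num.sg k)%:~R * derive1n 2 (fun b : R => lambda (N := N) k b v) a
    & \forall x \near (0 : 'rV[R]_(1 + (2 * N).+1)),
        real_analytic_at (lambda_joint (N := N) 0) x]
  /\
  (forall (k : int), k != 0 -> (`|k| <= N)%N ->
    [/\ (`|k|%N%:R < N.+1%:R / 2 :> R) ->
          (fun v : 'rV[R]_((2 * N).+1) =>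
             lambda_minus (N := N) k v
             - (s_ R N `|k| * (Num.sg k)%:~R
                + N.+1%:R^-1 *
                  \sum_(1 <= n < N.+2)
                    (c_ R N (n%:Z * k) ^+ 2 * coord1 v (2 * n - 1)
                     + s_ R N (n%:Z * k) ^+ 2 * coord1 v (2 * n))))
          =O_ (0 : 'rV[R]_((2 * N).+1)) (fun v => eucl_norm v ^+ 2),
        (`|k|%N%:R >= N.+1%:R / 2 :> R) ->
          (fun v : 'rV[R]_((2 * N).+1) =>
             lambda_minus (N := N) k v - (Num.sg k)%:~R)
          =O_ (0 : 'rV[R]_((2 * N).+1)) (fun v => eucl_norm v)
      & (fun v : 'rV[R]_((2 * N).+1) =>
           lambda_plus (N := N) k v
           - (Num.sqrt (5 - 4 * c_ R N k) * (Num.sg k)%:~R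
              + \sum_(1 <= n < (2 * N).+2)
                  chi R N k n * coord1 v n / N.+1%:R))
        =O_ (0 : 'rV[R]_((2 * N).+1)) (fun v => eucl_norm v ^+ 2)]).
Proof.
split; [split|move=> k k0 kN; split].
- by move=> k _ kN a v /andP[a0 _]; apply: lambda_joint_analytic => //; rewrite gt_eqF.
- have pos : \forall delta \near (0 : R)^'+, 0 < delta by exact: nbhs_right_gt.
  apply: filterS pos => delta delta0.
  have : \forall v \near (0 : 'rV[R]_((2 * N).+1)), forall i : 'I_((2 * N).+1),
      i%:Z - N%:Z != 0 -> forall a, delta <= a <= 2 ->
      0 < (Num.sg (i%:Z - N%:Z))%:~R
          * derive1n 2 (fun b => lambda (N := N) (i%:Z - N%:Z) b v) a.
    apply: (@filter_forall _ _ _ (nbhs (0 : 'rV[R]_((2 * N).+1)))) => i; have [iN|iN] := eqVneq (i%:Z - N%:Z) 0.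
      by apply: (@filterE _ (nbhs (0 : 'rV[R]_((2 * N).+1)))) => v /eqP.
    have iN' : (absz (i%:Z - N%:Z)%R <= N)%N by have := ltn_ord i; lia.
    by apply: filterS (second_derivative_sign iN iN' delta0) => v + _.
  apply: filterS => v h k k0 kN.
  have kp : (absz (k + N%:Z)%R < (2 * N).+1)%N by lia.
  have kE : k = (Ordinal kp)%:Z - N%:Z by rewrite /=; lia.
  by rewrite kE in k0 *; exact: h.
- exact: lambda_joint0_analytic.
- move=> /c_gt0 c0; apply: bigO_eucl_sqr.
  have [D D0 h] := lambda_minus_interior k0 kN c0; exists D => //.
  by apply: filterS h => v; rewrite sg_expansion// -first_order_shift_c.
- move=> /(c_le0 kN) c0; apply/eqO_exP; exists (2 * N).+1%:R; first by rewrite ltr0n.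
  apply: (@filterE _ (nbhs (0 : 'rV[R]_((2 * N).+1)))) => v.
  rewrite -[X in _ - X]mulr1; apply: le_trans (lambda_minus_boundary k0 kN v c0) _.
  rewrite ler_wpM2l// ger0_norm ?sqrtr_ge0//; exact: le_eucl_norm.
- apply: bigO_eucl_sqr.
  have [D D0 h] := @lambda_plus_expansion R N k k0 kN; exists D => //.
  by apply: filterS h => v; rewrite sg_expansion// -first_order_shift_2.
Qed.
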